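(* Let $K=K_x\times K_y$ with $K_x\subset\mathbb{R}^n$, $K_y\subset\mathbb{R}^m$ closed convex sets, let $\varphi$ be $C^2$ and concave-convex on $K$, and let $\mathbf{0}\in K$ be a $K$-restricted saddle point of $\varphi$. Let $F$ be the minimal face of $K$ that contains all $K$-restricted saddle points and let $V$ be the affine span of $F$. Let $\mathbf{\Pi}$ be the orthogonal projection matrix onto the orthogonal complement of $N_V$. If the subgradient method on $K$ applied to $\varphi$ has no non-constant trajectory $\mathbf{z}(t)$ that satisfies both (i) the linear ODE $\dot{\mathbf{z}}(t)=\mathbf{\Pi}\mathbf{A}(\mathbf{0})\mathbf{\Pi}\mathbf{z}(t)$, and (ii) for all $r\in[0,1]$ and $t\in\mathbb{R}$, $$\mathbf{z}(t)\in\ker(\mathbf{\Pi}\mathbf{B}(r\mathbf{z}(t))\mathbf{\Pi})\cap\ker(\mathbf{\Pi}(\mathbf{A}(r\mathbf{z}(t))-\mathbf{A}(\mathbf{0}))\mathbf{\Pi}),$$ then the subgradient method is globally convergent.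
   Context: $\varphi(x,y)$, $x\in\mathbb{R}^n$, $y\in\mathbb{R}^m$, is concave-convex if it is concave in $x$ and convex in $y$. A $K$-restricted saddle point is $(\bar x,\bar y)\in K$ with $\varphi(x,\bar y)\le\varphi(\bar x,\bar y)\le\varphi(\bar x,y)$ for all $x,y$ with $(x,\bar y),(\bar x,y)\in K$. The matrices $\mathbf{A},\mathbf{B}$ are $$\mathbf{A}(\mathbf{z})=\begin{bmatrix}0&\varphi_{xy}(\mathbf{z})\\-\varphi_{yx}(\mathbf{z})&0\end{bmatrix},\qquad \mathbf{B}(\mathbf{z})=\begin{bmatrix}\varphi_{xx}(\mathbf{z})&0\\0&-\varphi_{yy}(\mathbf{z})\end{bmatrix}.$$ The normal cone is $N_K(\mathbf{z})=\{\mathbf{w}:\mathbf{w}^T(\mathbf{z}'-\mathbf{z})\le0\ \forall \mathbf{z}'\in K\}$ for $\mathbf{z}\in K$; for an affine subspace $V$ it is independent of $\mathbf{z}\in V$ and denoted $N_V$. $\mathbf{P}_C$ is Euclidean projection onto $C$. The subgradient method on $K$ applied to $\varphi$ is the semi-flow on $K$ (with Euclidean metric) consisting of Carathéodory solutions (absolutely continuous, satisfying the equation for almost all $t$) of $\dot{\mathbf{z}}=\mathbf{f}(\mathbf{z})-\mathbf{P}_{N_K(\mathbf{z})}(\mathbf{f}(\mathbf{z}))$, $\mathbf{f}=(\varphi_x,-\varphi_y)$. A semi-flow is globally convergent if for every initial condition the trajectory converges to an equilibrium point as $t\to\infty$. A face of $K$ is a convex subset $F\subseteq K$ such that every line segment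 $L\subseteq K$ with $(\operatorname{relint}L)\cap F\neq\emptyset$ satisfies $L\subseteq F$. The minimal face containing a set is the intersection of all faces containing it. *)

(* Defs.v *)
(* Points of R^n are column vectors 'cV[R]_n. *)
From HB Require Import structures.
From mathcomp Require Import all_boot all_order all_algebra.
From mathcomp Require Import all_classical all_reals all_analysis.

Set Implicit Arguments.
Unset Strict Implicit.
Unset Printing Implicit Defensive.

Import Order.TTheory GRing.Theory Num.Theory.
Import numFieldNormedType.Exports.

Local Open Scope classical_set_scope.
Local Open Scope ring_scope.

Section EuclideanGeometry.
Context {R : realType} {p : nat}.
Local Notation E := 'cV[R]_p.
Implicit Types (u v w z a b : E) (C K F V S : set E).

Definition dot u v : R := (u^T *m v) ord0 ord0.

(* The norm `|u| of the library on matrices is the sup norm; it induces the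
   same topology, but projections have to use this one. *)
Definition euclidean_norm u : R := Num.sqrt (dot u u).

(* The nearest point of C to v; it exists and is unique when C is closed,
   convex and nonempty (default value 0 otherwise). *)
Definition euclidean_proj C v : E :=
  xget 0 [set q | C q /\
    forall q', C q' -> euclidean_norm (v - q) <= euclidean_norm (v - q')].

Definition normal_cone K z : set E :=
  [set w | forall z', K z' -> dot w (z' - z) <= 0].

(* For an affine subspace V the normal cone does not depend on the base point
   in V; this is the common value. *)
Definition affine_normal_cone V : set E :=
  [set w | forall z, V z -> normal_cone V z w].

Definition orth_complement S : set E :=
  [set u | forall w, S w -> dot u w = 0].

Definition segment a b : set E :=
  [set (1 - t) *: a + t *: b | t in `[0, 1]%classic].

(* For a = b this is [set a], which is indeed the relative interior. *)
Definition relint_segment a b : set E :=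
  [set (1 - t) *: a + t *: b | t in `]0, 1[%classic].

Definition is_face K F : Prop :=
  [/\ F `<=` K, convex_set F &
      forall a b, segment a b `<=` K ->
        relint_segment a b `&` F !=set0 -> segment a b `<=` F].

Definition minimal_face K S : set E :=
  \bigcap_(F in [set F | is_face K F /\ S `<=` F]) F.

Definition is_affine V : Prop :=
  forall a b (t : R), V a -> V b -> V ((1 - t) *: a + t *: b).

Definition affine_span S : set E :=
  \bigcap_(V in [set V | is_affine V /\ S `<=` V]) V.

(* Null space for the action on column vectors (kermx is the left kernel). *)
Definition null_space (M : 'M[R]_p) : set E := [set v | M *m v = 0].

End EuclideanGeometry.

Section Differentiation.
Context {R : realType} {p : nat}.
Implicit Types (g : 'cV[R]_p -> R) (U : set 'cV[R]_p).

Definition partial g (i : 'I_p) : 'cV[R]_p -> R :=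
  'D_(delta_mx i ord0 : 'cV[R]_p) g.

Definition gradient g z : 'cV[R]_p := \col_i partial g i z.

Definition hessian g z : 'M[R]_p := \matrix_(i, j) partial (partial g i) j z.

(* Meant for open U. *)
Definition C1_on U g : Prop :=
  forall i z, U z ->
    derivable g z (delta_mx i ord0 : 'cV[R]_p) /\ {for z, continuous (partial g i)}.

Definition C2_on U g : Prop := C1_on U g /\ forall i, C1_on U (partial g i).

(* On a set that is not open, C^2 means C^2 on an open neighbourhood of it. *)
Definition C2_near (K : set 'cV[R]_p) g : Prop :=
  exists U, [/\ open U, K `<=` U & C2_on U g].

End Differentiation.

Section SemiFlows.
Context {R : realType} {p : nat}.
Local Notation E := 'cV[R]_p.
Implicit Types (X : set E) (Phi : R -> E -> E) (z : R -> E).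

(* Only the values of Phi at t >= 0 and points of X matter. *)
Definition is_semiflow X Phi : Prop :=
  [/\ forall t x, 0 <= t -> X x -> X (Phi t x),
      forall x, X x -> Phi 0 x = x,
      forall s t x, 0 <= s -> 0 <= t -> X x -> Phi (t + s) x = Phi t (Phi s x) &
      {within [set q : R * E | 0 <= q.1 /\ X q.2],
        continuous (fun q : R * E => Phi q.1 q.2)}].

Definition equilibrium X Phi (e : E) : Prop :=
  X e /\ forall t, 0 <= t -> Phi t e = e.

Definition globally_convergent X Phi : Prop :=
  forall x, X x ->
    exists e, equilibrium X Phi e /\ Phi t x @[t --> +oo] --> e.

(* A trajectory defined for all times t in R. *)
Definition complete_trajectory X Phi z : Prop :=
  (forall t, X (z t)) /\ forall s t, 0 <= s -> z (t + s) = Phi s (z t).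

Definition absolutely_continuous_on (a b : R) z : Prop :=
  forall e : R, 0 < e -> exists2 d : R, 0 < d &
    forall k (I : 'I_k -> R * R),
      (forall i, [/\ a <= (I i).1, (I i).1 <= (I i).2 & (I i).2 <= b]) ->
      trivIset setT (fun i => `](I i).1, (I i).2[%classic) ->
      \sum_i ((I i).2 - (I i).1) < d ->
      \sum_i `|z (I i).2 - z (I i).1| < e.

Definition caratheodory_solution X (g : E -> E) z : Prop :=
  [/\ forall t, 0 <= t -> X (z t),
      forall T, 0 <= T -> absolutely_continuous_on 0 T z &
      {ae (@lebesgue_measure R), forall t : R, 0 <= t -> is_derive t 1 z (g (z t))}].

End SemiFlows.

Section SaddlePoints.
Context {R : realType} {n m : nat}.
Implicit Types (phi : 'cV[R]_n -> 'cV[R]_m -> R) (K : set 'cV[R]_(n + m)).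
Implicit Types (Kx : set 'cV[R]_n) (Ky : set 'cV[R]_m) (z : 'cV[R]_(n + m)).

(* z = col_mx x y stands for (x, y). *)
Definition joint phi z : R := phi (usubmx z) (dsubmx z).

Definition product_set Kx Ky : set 'cV[R]_(n + m) :=
  [set z | Kx (usubmx z) /\ Ky (dsubmx z)].

Definition concave_convex_on Kx Ky phi : Prop :=
  (forall y, Ky y -> convex_function Kx (fun x => - phi x y)) /\
  (forall x, Kx x -> convex_function Ky (phi x)).

Definition restricted_saddle K phi : set 'cV[R]_(n + m) :=
  [set z | K z /\ forall x y,
    K (col_mx x (dsubmx z)) -> K (col_mx (usubmx z) y) ->
    phi x (dsubmx z) <= phi (usubmx z) (dsubmx z) <= phi (usubmx z) y].

Definition phi_xx phi z : 'M[R]_n := ulsubmx (hessian (joint phi) z).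
Definition phi_xy phi z : 'M[R]_(n, m) := ursubmx (hessian (joint phi) z).
Definition phi_yx phi z : 'M[R]_(m, n) := dlsubmx (hessian (joint phi) z).
Definition phi_yy phi z : 'M[R]_m := drsubmx (hessian (joint phi) z).

Definition matA phi z : 'M[R]_(n + m) :=
  block_mx 0 (phi_xy phi z) (- phi_yx phi z) 0.

Definition matB phi z : 'M[R]_(n + m) :=
  block_mx (phi_xx phi z) 0 0 (- phi_yy phi z).

Definition saddle_field phi z : 'cV[R]_(n + m) :=
  col_mx (usubmx (gradient (joint phi) z)) (- dsubmx (gradient (joint phi) z)).

Definition subgradient_field K phi z : 'cV[R]_(n + m) :=
  saddle_field phi z - euclidean_proj (normal_cone K z) (saddle_field phi z).

Definition is_subgradient_method K phi
    (Phi : R -> 'cV[R]_(n + m) -> 'cV[R]_(n + m)) : Prop :=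
  is_semiflow K Phi /\
  forall z0, K z0 ->
    caratheodory_solution K (subgradient_field K phi) (Phi ^~ z0).

End SaddlePoints.

(* Main.v *)
(* The flow is a contraction semigroup and its fixed points are the saddle points.  An orbit
   has a cluster point y that is recurrent; if y is an equilibrium the orbit converges to it.
   Otherwise fix times s_k -> oo with Phi_(s_k) y -> y.  The set I of all c with
   Phi_(s_k) c -> c is closed, convex, contains 0, and the flow acts on it as a group of affine
   isometries fixing 0; hence y lies on a complete trajectory z in I.
   - An element of least norm in a suitable invariant convex subset of I is an equilibrium
     whose minimal face contains z, so z stays in F, a subset of V.
   - Distances to saddle points are constant along z.  Applied to 0 and to a relative interior
     saddle point, this forces the normal component of the field to be orthogonal to V, so
     z' = Pi f(z).
   - As r z is again a trajectory, Pi f(r z) = r Pi f(z) and <f(r z), z> = 0 for r in [0, 1].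
     Differentiating in r gives Pi (A + B)(r z) z = Pi f(z) and <B(r z) z, z> = 0.
     Monotonicity of f makes Pi B(r z) Pi negative semidefinite, so Pi B(r z) z = 0 and
     Pi A(r z) z = Pi f(z) does not depend on r: this is (i) and (ii) for the nonconstant z. *)
Require Import Defs.
From HB Require Import structures.
From mathcomp Require Import all_boot all_order all_algebra.
From mathcomp Require Import all_classical all_reals all_analysis.
From mathcomp Require Import ring lra.
Set Implicit Arguments.
Unset Strict Implicit.
Unset Printing Implicit Defensive.
Import Order.TTheory GRing.Theory Num.Theory.
Import numFieldNormedType.Exports.
Local Open Scope classical_set_scope.
Local Open Scope ring_scope.

(** * Euclidean inner product *)

(** Two obstacles shape the argument. Geometry: an orbit closure need not be convex, so scaling,
    averaging and faces are out of reach there. Convexity of I is obtained by a squeeze: the flow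
    does not shrink distances on I, and in the Euclidean norm a nonexpansive map that keeps the
    distance of two points is affine on their segment. The margin with which a point of I dominates
    the orbit is fixed in advance, because a uniform margin survives limits and makes the competing
    set closed; only then does a least norm element exist. Regularity: solutions obey their equation
    almost everywhere, and the subgradient field may jump at the boundary of K. Almost-everywhere
    bounds are integrated by [ae_derive_le]. On I the field reduces to Pi f, which is continuous, so
    the equation holds at every time; this allows the velocities of z and r z to be compared at a
    single instant. The Jacobian is negative semidefinite only along feasible directions, hence only
    between two factors Pi and only at points of F. Its form vanishes on z, and a null vector of a
    semidefinite form lies in the kernel of the symmetric part B; the skew part A is invisible to
    the form. *)

Section Dot.
Context {R : realType} {p : nat}.
Local Notation E := 'cV[R]_p.
Implicit Types (u v w a b c q : E).

Lemma dotE u v : dot u v = \sum_i u i 0 * v i 0.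
Proof. by rewrite /dot mxE; apply: eq_bigr => i _; rewrite mxE. Qed.

Lemma dotC u v : dot u v = dot v u.
Proof. by rewrite !dotE; apply: eq_bigr => i _; rewrite mulrC. Qed.

Lemma dotDl u v w : dot (u + v) w = dot u w + dot v w.
Proof. by rewrite /dot linearD/= mulmxDl mxE. Qed.

Lemma dotDr u v w : dot w (u + v) = dot w u + dot w v.
Proof. by rewrite dotC dotDl !(dotC w). Qed.

Lemma dotNl u w : dot (- u) w = - dot u w.
Proof. by rewrite /dot linearN/= mulNmx mxE. Qed.

Lemma dotNr u w : dot w (- u) = - dot w u.
Proof. by rewrite dotC dotNl dotC. Qed.

Lemma dotNN u w : dot (- u) (- w) = dot u w.
Proof. by rewrite dotNl dotNr opprK. Qed.

Lemma dotZl (k : R) u w : dot (k *: u) w = k * dot u w.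
Proof. by rewrite /dot linearZ/= -scalemxAl mxE. Qed.

Lemma dotZr (k : R) u w : dot w (k *: u) = k * dot w u.
Proof. by rewrite dotC dotZl dotC. Qed.

Lemma dot0l w : dot 0 w = 0.
Proof. by rewrite -(scale0r 0) dotZl mul0r. Qed.

Lemma dot0r w : dot w 0 = 0.
Proof. by rewrite dotC dot0l. Qed.

Definition dot_lin :=
  (dotDl, dotDr, dotNl, dotNr, dotZl, dotZr, dot0l, dot0r).

Lemma dot_mulmx (M : 'M[R]_p) u v : dot (M *m u) v = dot u (M^T *m v).
Proof. by rewrite /dot trmx_mul mulmxA. Qed.

Lemma dot_ge0 u : 0 <= dot u u.
Proof. by rewrite dotE sumr_ge0// => i _; rewrite -expr2 sqr_ge0. Qed.

Lemma sqr_coord_le_dot u i : (u i 0) ^+ 2 <= dot u u.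
Proof.
rewrite dotE (bigD1 i)//= -expr2 lerDl sumr_ge0// => j _.
by rewrite -expr2 sqr_ge0.
Qed.

(** Limits are taken in the sup norm [|u|], whereas contraction is measured by [dot]. This bound and
    [norm_dot_le] are the passage between the two. *)
Lemma sqr_norm_le_dot u : `|u| ^+ 2 <= dot u u.
Proof.
have [->|u0] := eqVneq u 0; first by rewrite normr0 expr0n/= dot0l.
have /mx_norm_neq0[[i j]/= uij] : mx_norm u != 0.
  by apply: contra u0 => /eqP/mx_norm_eq0 ->.
rewrite [`|u|]uij ord1 -normrX ger0_norm ?sqr_ge0//.
exact: sqr_coord_le_dot.
Qed.

Lemma dot_eq0 u : dot u u = 0 -> u = 0.
Proof.
move=> u0; apply/eqP; rewrite -normr_eq0 -sqrf_eq0 eq_le sqr_ge0 andbT.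
by rewrite -u0 sqr_norm_le_dot.
Qed.

Lemma dot_le0 u : dot u u <= 0 -> u = 0.
Proof. by move=> u0; apply: dot_eq0; apply/eqP; rewrite eq_le u0 dot_ge0. Qed.

Lemma coord_le_norm u i : `|u i 0| <= `|u|.
Proof.
rewrite [leRHS]/Num.Def.normr/= mx_normrE.
exact: (le_bigmax _ (fun ij : 'I_p * 'I_1 => `|u ij.1 ij.2|) (i, 0)).
Qed.

Lemma norm_dot_le u v : `|dot u v| <= p%:R * (`|u| * `|v|).
Proof.
rewrite dotE (le_trans (ler_norm_sum _ _ _))//.
rewrite mulr_natl -[X in _ *+ X]card_ord -sumr_const ler_sum// => i _.
by rewrite normrM ler_pM// coord_le_norm.
Qed.

Lemma eq_dot u v : (forall w, dot w u = dot w v) -> u = v.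
Proof.
move=> uv; apply/eqP; rewrite -subr_eq0; apply/eqP/dot_eq0.
by rewrite [in LHS]dotDr dotNr uv subrr.
Qed.

(** Stewart's identity. Strict convexity enters through it: a point no farther from [a] and from [b]
    than a convex combination of them is equal to that combination. *)
Lemma dot_dist_conv (t : R) a b q :
  dot (q - ((1 - t) *: a + t *: b)) (q - ((1 - t) *: a + t *: b)) =
  (1 - t) * dot (q - a) (q - a) + t * dot (q - b) (q - b)
  - t * (1 - t) * dot (a - b) (a - b).
Proof. by rewrite !dot_lin (dotC b a) (dotC a q) (dotC b q); ring. Qed.

Lemma euclidean_norm_le u v :
  (euclidean_norm u <= euclidean_norm v) = (dot u u <= dot v v).
Proof. by rewrite ler_sqrt// dot_ge0. Qed.

End Dot.

(** * Entrywise limits of matrices *)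

Section MatrixLimits.
Context {R : realType}.

Lemma cvg_mx_coord {T : Type} {F : set_system T} {FF : Filter F} {m n : nat}
    (f : T -> 'M[R]_(m, n)) (l : 'M[R]_(m, n)) :
  (forall i j, f x i j @[x --> F] --> l i j) -> f x @[x --> F] --> l.
Proof.
move=> fl; apply/cvgrPdist_le => /= e e0; near=> x.
rewrite /Num.Def.normr/= mx_normrE (bigmax_le _ (ltW e0))//= => -[i j] _.
rewrite !mxE/=; move: i j; near: x.
apply: filter_forall => i; apply: filter_forall => j.
by move/cvgrPdist_le : (fl i j); exact.
Unshelve. all: by end_near. Qed.

Lemma cvg_coord {T : Type} {F : set_system T} {FF : Filter F} {m n : nat}
    (f : T -> 'M[R]_(m, n)) (l : 'M[R]_(m, n)) i j :
  f x @[x --> F] --> l -> f x i j @[x --> F] --> l i j.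
Proof.
by move=> fl; exact: (@cvg_comp _ _ _ f (fun M => M i j) F _ _ fl
  (@coord_continuous R m n i j l)).
Qed.

Lemma cvg_sum_ord {T : Type} {F : set_system T} {FF : Filter F} {k : nat}
    (f : 'I_k -> T -> R) (l : 'I_k -> R) :
  (forall i, f i x @[x --> F] --> l i) ->
  \sum_i f i x @[x --> F] --> \sum_i l i.
Proof. by move=> fl; apply: cvg_big => //; exact: add_continuous. Qed.

Lemma cvg_mulmx {T : Type} {F : set_system T} {FF : Filter F} {m n p : nat}
    (f : T -> 'M[R]_(m, n)) (g : T -> 'M[R]_(n, p)) (l : 'M[R]_(m, n)) (k : 'M[R]_(n, p)) :
  f x @[x --> F] --> l -> g x @[x --> F] --> k ->
  f x *m g x @[x --> F] --> l *m k.
Proof.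
move=> fl gk; apply: cvg_mx_coord => i j; rewrite mxE.
under eq_cvg do rewrite mxE.
by apply: cvg_sum_ord => a; apply: cvgM; exact: cvg_coord.
Qed.

Lemma cvg_dot {T : Type} {F : set_system T} {FF : Filter F} {p : nat}
    (f g : T -> 'cV[R]_p) (l k : 'cV[R]_p) :
  f x @[x --> F] --> l -> g x @[x --> F] --> k ->
  dot (f x) (g x) @[x --> F] --> dot l k.
Proof.
move=> fl gk; rewrite dotE; under eq_cvg do rewrite dotE.
by apply: cvg_sum_ord => a; apply: cvgM; exact: cvg_coord.
Qed.

Lemma cvg_dot_dist0 {T : Type} {F : set_system T} {FF : Filter F} {p : nat}
    (f : T -> 'cV[R]_p) (l : 'cV[R]_p) :
  dot (f x - l) (f x - l) @[x --> F] --> 0 -> f x @[x --> F] --> l.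
Proof.
move=> /cvgrPdist_lt fl; apply/cvgrPdist_lt => /= e e0.
have := fl (e ^+ 2); rewrite exprn_gt0// => /(_ isT).
apply: filterS => x; rewrite sub0r normrN ger0_norm ?dot_ge0// => fx.
rewrite -(ltr_pXn2r (ltn0Sn 1)) ?nnegrE ?(ltW e0)//.
by rewrite distrC (le_lt_trans (sqr_norm_le_dot _)).
Qed.

End MatrixLimits.

(** * Derivatives from continuous partial derivatives *)

Section Derivatives.
Context {R : realType}.

Lemma is_deriveP {V W : normedModType R} (f : V -> W) (x v : V) (df : W) :
  is_derive x v f df <-> h^-1 *: (f (h *: v + x) - f x) @[h --> 0^'] --> df.
Proof.
split=> [[fxv <-]|fdf]; first exact: fxv.
by split; [apply/cvg_ex; exists df|exact: cvg_lim].
Qed.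

Lemma is_derive_mx {V : normedModType R} {m n : nat} (M : V -> 'M[R]_(m, n))
    x v (D : 'M[R]_(m, n)) :
  (forall i j, is_derive x v (fun y => M y i j) (D i j)) -> is_derive x v M D.
Proof.
move=> MD; apply/is_deriveP/cvg_mx_coord => i j.
under eq_cvg do rewrite !mxE.
by have /is_deriveP := MD i j.
Qed.

Lemma is_derive_coord {V : normedModType R} {m n : nat} (M : V -> 'M[R]_(m, n))
    x v (D : 'M[R]_(m, n)) i j :
  is_derive x v M D -> is_derive x v (fun y => M y i j) (D i j).
Proof.
move=> /is_deriveP MD; apply/is_deriveP.
apply: cvg_trans (cvg_coord (i := i) (j := j) MD).
by apply: near_eq_cvg; apply: nearW => h; rewrite !mxE.
Qed.

Lemma is_derive_sum_fun {V : normedModType R} {k : nat} (f : 'I_k -> V -> R) x v df :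
  (forall i, is_derive x v (f i) (df i)) ->
  is_derive x v (fun y => \sum_i f i y) (\sum_i df i).
Proof.
move=> fdf; have := is_derive_sum fdf.
by rewrite (_ : \sum_i f i = fun y => \sum_i f i y)//; apply/funext => y; rewrite fct_sumE.
Qed.

Lemma is_derive_mulmxr {V : normedModType R} {m n p : nat} (A : 'M[R]_(m, n))
    (M : V -> 'M[R]_(n, p)) x v (D : 'M[R]_(n, p)) :
  is_derive x v M D -> is_derive x v (fun y => A *m M y) (A *m D).
Proof.
move=> MD; apply: is_derive_mx => i j; rewrite mxE.
under eq_fun do rewrite mxE.
apply: is_derive_sum_fun => k.
exact: (@is_deriveZ _ _ _ _ (A i k) _ _ _ (is_derive_coord k j MD)).
Qed.

Lemma is_derive_dot {V : normedModType R} {p : nat} (f g : V -> 'cV[R]_p)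
    x v (df dg : 'cV[R]_p) :
  is_derive x v f df -> is_derive x v g dg ->
  is_derive x v (fun y => dot (f y) (g y)) (dot (f x) dg + dot df (g x)).
Proof.
move=> fdf gdg; rewrite !dotE -big_split/=.
under eq_fun do rewrite dotE.
apply: is_derive_sum_fun => i; rewrite [df _ _ * _]mulrC.
exact: is_deriveM (is_derive_coord i 0 fdf) (is_derive_coord i 0 gdg).
Qed.

Lemma is_derive_continuous {W : normedModType R} (f : R -> W) (x : R) (df : W) :
  is_derive x 1 f df -> {for x, continuous f}.
Proof. by case=> /derivable1_diffP/differentiable_continuous. Qed.

Lemma is_derive_line {p : nat} (a v : 'cV[R]_p) (s : R) :
  is_derive s 1 (fun s : R => a + s *: v) v.
Proof.
apply/is_deriveP; apply: cvg_near_cst.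
near=> h; have h0 : h != 0 by near: h; exact: nbhs_dnbhs_neq.
by rewrite [_%:A]mulr1 opprD addrACA subrr add0r -scalerBl addrK scalerA mulVf// scale1r.
Unshelve. all: by end_near. Qed.

End Derivatives.

Section StrongDerivative.
Context {R : realType} {p : nat}.
Local Notation E := 'cV[R]_p.
Implicit Types (g : E -> R) (z v w : E) (U : set E).

(** Strict differentiability in the direction [v]: the error is uniform in the base point [w] near
    [z]. This makes it additive in [v], where the second increment starts from a shifted base
    point. *)
Definition strong_derive g z v (l : R) := forall e : R, 0 < e ->
  \forall w \near z & h \near (0 : R),
    `|g (h *: v + w) - g w - h * l| <= e * `|h|.

Lemma near_shift (P : E -> R -> Prop) z v :
  (\forall w \near z & h \near (0 : R), P w h) ->
  \forall w \near z & h \near (0 : R), P (h *: v + w) h.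
Proof.
move=> zP.
have F2 : (fun q : E * R => q.2) @ filter_prod (nbhs z) (nbhs (0 : R)) --> (0 : R)
  by exact: cvg_snd.
have F1 : (fun q : E * R => q.2 *: v + q.1) @ filter_prod (nbhs z) (nbhs (0 : R)) -->
    0 *: v + z.
  by apply: cvgD; [apply: cvgZr_tmp; exact: cvg_snd|exact: cvg_fst].
rewrite scale0r add0r in F1.
exact: (cvg_pair F1 F2 zP).
Qed.

Lemma near_prod (P : E -> Prop) (Q : R -> Prop) z :
  (\forall w \near z, P w) -> (\forall h \near (0 : R), Q h) ->
  \forall w \near z & h \near (0 : R), P w /\ Q h.
Proof. by move=> zP Q0; exists (P, Q). Qed.

Lemma near_scale (P : E -> R -> Prop) z (k : R) :
  (\forall w \near z & h \near (0 : R), P w h) ->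
  \forall w \near z & h \near (0 : R), P w (h * k).
Proof.
move=> zP.
have F2 : (fun q : E * R => q.2 * k) @ filter_prod (nbhs z) (nbhs (0 : R)) --> 0 * k.
  by apply: cvgM; [exact: cvg_snd|exact: cvg_cst].
have F1 : (fun q : E * R => q.1) @ filter_prod (nbhs z) (nbhs (0 : R)) --> z
  by exact: cvg_fst.
rewrite mul0r in F2; exact: (cvg_pair F1 F2 zP).
Qed.

Lemma strong_derive0 g z : strong_derive g z 0 0.
Proof.
move=> e e0; near=> w h.
by rewrite scaler0 add0r subrr mulr0 subrr normr0 mulr_ge0// ltW.
Unshelve. all: by end_near. Qed.

Lemma strong_deriveD g z v1 v2 l1 l2 :
  strong_derive g z v1 l1 -> strong_derive g z v2 l2 ->
  strong_derive g z (v1 + v2) (l1 + l2).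
Proof.
move=> g1 g2 e e0; have e20 : 0 < e / 2 by rewrite divr_gt0.
have := near_shift v2 (g1 _ e20); have := g2 _ e20.
apply: filterS2 => -[w h]/= H2 H1.
rewrite scalerDr -(addrA (h *: v1)) mulrDr [in leRHS](splitr e) [leRHS]mulrDl.
apply: le_trans (lerD H1 H2); apply: le_trans (ler_normD _ _).
by rewrite le_eqVlt; apply/orP; left; apply/eqP; congr `|_|; ring.
Qed.

Lemma strong_deriveZ g z v l (k : R) :
  strong_derive g z v l -> strong_derive g z (k *: v) (k * l).
Proof.
move=> gl e e0; have k0 : 0 < `|k| + 1 by rewrite ltr_wpDl.
have ek0 : 0 < e / (`|k| + 1) by rewrite divr_gt0.
have := near_scale k (gl _ ek0).
apply: filterS => -[w h]/=; rewrite scalerA mulrA => /le_trans; apply.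
rewrite mulrAC ler_pdivrMr// -mulrA ler_wpM2l ?(ltW e0)//.
by rewrite normrM ler_wpM2l// lerDl.
Qed.

Lemma norm_delta_le1 (i : 'I_p) : `|delta_mx i 0 : E| <= 1.
Proof.
rewrite [leLHS]/Num.Def.normr/= mx_normrE bigmax_le// => ij _.
by rewrite mxE normr_nat lern1 leq_b1.
Qed.

Lemma strong_derive_partial U g z i :
  open U -> U z -> C1_on U g ->
  strong_derive g z (delta_mx i 0) (partial g i z).
Proof.
move=> oU Uz g1 e e0; set d := delta_mx i 0.
have d1 : `|d| <= 1 := norm_delta_le1 i.
have : \forall w \near z, U w /\ `|partial g i z - partial g i w| <= e.
  have [_ /cvgrPdist_le/(_ _ e0) H] := g1 i z Uz.
  by apply: filterS2 (open_nbhs_nbhs (conj oU Uz)) H.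
move=> /nbhs_ballP[r /= r0 zr].
have main w h : `|z - w| < r / 2 -> 0 < h -> h < r / 2 ->
    `|g (h *: d + w) - g w - h * partial g i z| <= e * `|h|.
  move=> zw h0 hr.
  have near_w (s : R) : s \in `[0, h] -> ball z r (s *: d + w).
    rewrite in_itv/= => /andP[s0 sh]; rewrite -ball_normE/=.
    have -> : z - (s *: d + w) = (z - w) - s *: d by rewrite opprD addrCA addrC.
    rewrite (le_lt_trans (ler_normB _ _))// (splitr r) ltr_leD//.
    rewrite normrZ ger0_norm// (le_trans (ler_wpM2l s0 d1))// mulr1.
    by rewrite (le_trans sh)// ltW.
  have dk (s : R) : s \in `[0, h] ->
      is_derive s 1 (fun s => g (s *: d + w)) (partial g i (s *: d + w)).
    move=> /near_w/zr[Us _]; have [/derivableP/is_deriveP H _] := g1 i _ Us.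
    apply/is_deriveP; apply: cvg_trans H; apply: near_eq_cvg; apply: nearW => t.
    by rewrite [_%:A]mulr1 scalerDl addrA.
  pose G (s : R) := g (s *: d + w); pose G' (s : R) := partial g i (s *: d + w).
  have dG s : s \in `]0, h[ -> is_derive s 1 G (G' s).
    by move=> sh; apply: dk; apply: subset_itv_oo_cc sh.
  have cG : {within `[0, h], continuous G}.
    apply: continuous_in_subspaceT => s; rewrite inE => sh.
    exact: (is_derive_continuous (dk s sh)).
  have [c ch] := MVT h0 dG cG; rewrite /G /G'.
  rewrite scale0r add0r subr0 => ->.
  rewrite [h * _]mulrC -mulrBl normrM ler_wpM2r//.
  rewrite distrC; apply: (zr _ _).2; apply: near_w; exact: subset_itv_oo_cc ch.
have r2 : 0 < r / 2 by rewrite divr_gt0.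
have r4 : 0 < r / 2 / 2 by rewrite divr_gt0.
have Z : \forall w \near z, `|z - w| < r / 2 / 2.
  by have := nbhsx_ballx z _ r4; rewrite -ball_normE.
have H : \forall h \near (0 : R), `|h| < r / 2 / 2 by exact: (nbhs0_lt r4).
have r42 : r / 2 / 2 < r / 2 by rewrite ltr_pdivrMr// mulr2n mulrDr mulr1 ltrDl.
have := near_prod Z H; apply: filterS => -[w h]/= [zw hr].
have [h0|h0|->] := ltgtP h 0.
(* A negative step is a positive one with the endpoints exchanged; the radius [r / 2 / 2] leaves
   room for the shifted base point. *)
- have := main (h *: d + w) (- h).
  rewrite !oppr_gt0 scaleNr addKr !normrN mulNr opprK => H'.
  rewrite -normrN opprD opprB opprK H'//; last first.
    by rewrite -(ltr0_norm h0) (lt_trans hr).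
  rewrite opprD addrCA addrC (le_lt_trans (ler_normB _ _))// (splitr (r / 2)) ltr_leD//.
  by rewrite normrZ (le_trans (ler_wpM2l _ d1))// mulr1 ltW.
- apply: main => //; first exact: lt_trans zw _.
  by rewrite -(gtr0_norm h0) (lt_trans hr).
- by rewrite scale0r add0r subrr mul0r subrr normr0 mulr_ge0// ltW.
Qed.

Lemma strong_derive_gradient U g z v :
  open U -> U z -> C1_on U g -> strong_derive g z v (dot (gradient g z) v).
Proof.
move=> oU Uz g1.
have {1}-> : v = \sum_i v i 0 *: delta_mx i 0.
  apply/colP => i; rewrite summxE (bigD1 i)//= !mxE !eqxx mulr1 big1 ?addr0// => j ji.
  by rewrite !mxE eq_sym (negbTE ji) mulr0.
rewrite dotE; elim/big_ind2 : _ => [|v1 l1 v2 l2|i _]; first exact: strong_derive0.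
  exact: strong_deriveD.
rewrite mxE mulrC; apply: strong_deriveZ; exact: strong_derive_partial oU Uz g1.
Qed.

Lemma strong_derive_is_derive g z v l : strong_derive g z v l -> is_derive z v g l.
Proof.
move=> gl; apply/is_deriveP/cvgrPdist_le => /= e e0.
have [[P Q]/= [zP Q0] PQ] := gl _ e0.
rewrite near_withinE; have := Q0; apply: filterS => h Qh h0.
have /= H := PQ (z, h) (conj (nbhs_singleton zP) Qh).
have -> : l - h^-1 *: (g (h *: v + z) - g z) = - (h^-1 * (g (h *: v + z) - g z - h * l)).
  by rewrite [_ *: _ in LHS](_ : _ = h^-1 * (g (h *: v + z) - g z))//; field.
by rewrite normrN normrM normfV ler_pdivrMl ?normr_gt0// [leRHS]mulrC.
Qed.

Lemma is_derive_along U g a v (s : R) :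
  open U -> U (a + s *: v) -> C1_on U g ->
  is_derive s 1 (fun s => g (a + s *: v)) (dot (gradient g (a + s *: v)) v).
Proof.
move=> oU Ua g1.
have /is_deriveP H := strong_derive_is_derive (strong_derive_gradient v oU Ua g1).
apply/is_deriveP; apply: cvg_trans H; apply: near_eq_cvg; apply: nearW => h.
by rewrite [_%:A]mulr1 addrCA -scalerDl.
Qed.
End StrongDerivative.

(** * Symmetry of the Hessian and the saddle field *)

Section Schwarz.
Context {R : realType} {p : nat}.
Local Notation E := 'cV[R]_p.
Implicit Types (g : E -> R) (z v w : E) (U : set E).

Definition second_diff g z (i j : 'I_p) (h : R) :=
  g (h *: delta_mx i 0 + (h *: delta_mx j 0 + z)) - g (h *: delta_mx j 0 + z)
  - (g (h *: delta_mx i 0 + z) - g z).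

(** The mean value theorem in direction [i] turns the second difference into [h] times an increment
    of [partial g i] in direction [j] from an intermediate point; the uniform base point of
    [strong_derive] absorbs that point. *)
Lemma second_diff_approx U g z i j (e : R) :
  open U -> U z -> C2_on U g -> 0 < e ->
  \forall h \near 0^'+, `|second_diff g z i j h - h ^+ 2 * partial (partial g i) j z|
     <= e * h ^+ 2.
Proof.
move=> oU Uz [g1 g2] e0.
have [[P Q]/= [zP Q0] PQ] := strong_derive_partial j oU Uz (g2 i) e0.
have : \forall w \near z, P w /\ U w.
  by apply: filterS2 zP (open_nbhs_nbhs (conj oU Uz)).
move=> /nbhs_ballP[r /= r0 zr].
near=> h.
have h0 : 0 < h by near: h; exact: nbhs_right_gt.
have hr : h < r / 2 by near: h; apply: nbhs_right_lt; rewrite divr_gt0.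
have Qh : Q h by near: h; exact: (cvg_within _ Q0).
pose a (s : R) := s *: delta_mx i 0 + z.
pose b (s : R) := s *: delta_mx i 0 + (h *: delta_mx j 0 + z).
have nd (s : R) k : 0 <= s -> `|s *: (delta_mx k 0 : E)| <= s.
  by move=> s0; rewrite normrZ ger0_norm// ler_piMr// norm_delta_le1.
have near_a s : s \in `[0, h] -> ball z r (a s).
  rewrite in_itv/= => /andP[s0 sh]; rewrite -ball_normE/= /a opprD addrCA subrr addr0 normrN.
  by rewrite (le_lt_trans (nd _ _ s0))// (le_lt_trans sh)// (lt_trans hr)//
    ltr_pdivrMr// mulr2n mulrDr mulr1 ltrDl.
have near_b s : s \in `[0, h] -> ball z r (b s).
  rewrite in_itv/= => /andP[s0 sh]; rewrite -ball_normE/= /b.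
  rewrite addrA opprD addrCA subrr addr0 normrN (le_lt_trans (ler_normD _ _))//.
  by rewrite (splitr r) ltrD// (le_lt_trans (nd _ _ _))// ?(ltW h0)// (le_lt_trans sh).
have dline w s : U (s *: delta_mx i 0 + w) ->
    is_derive s 1 (fun s => g (s *: delta_mx i 0 + w)) (partial g i (s *: delta_mx i 0 + w)).
  move=> Uw; have [/derivableP/is_deriveP H _] := g1 i _ Uw.
  apply/is_deriveP; apply: cvg_trans H; apply: near_eq_cvg; apply: nearW => t.
  by rewrite [_%:A]mulr1 scalerDl addrA.
pose k s := g (b s) - g (a s); pose k' s := partial g i (b s) - partial g i (a s).
have dk s : s \in `[0, h] -> is_derive s 1 k (k' s).
  move=> sh; apply: is_deriveB; apply: dline.
    by have [] := zr _ (near_b _ sh).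
  by have [] := zr _ (near_a _ sh).
have dk' s : s \in `]0, h[ -> is_derive s 1 k (k' s).
  by move=> sh; apply: dk; apply: subset_itv_oo_cc sh.
have ck : {within `[0, h], continuous k}.
  apply: continuous_in_subspaceT => s; rewrite inE => sh.
  exact: (is_derive_continuous (dk s sh)).
have [c ch] := MVT h0 dk' ck.
rewrite {1 2}/k subr0 {1 2}/a {1 2}/b !scale0r !add0r => kE.
have -> : second_diff g z i j h = k' c * h.
  by rewrite -kE /second_diff; ring.
have /= := PQ (a c, h) (conj (zr _ (near_a _ (subset_itv_oo_cc ch))).1 Qh).
rewrite (_ : h *: delta_mx j 0 + a c = b c); last by rewrite /a /b addrCA.
rewrite -/(k' c) => H.
rewrite -[_ - _](_ : h * (k' c - h * partial (partial g i) j z) = _); last by ring.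
rewrite normrM (gtr0_norm h0) expr2 mulrCA ler_wpM2l// ?(ltW h0)//.
by rewrite (le_trans H)// gtr0_norm.
Unshelve. all: by end_near. Qed.

(** Exchanging the indices leaves [second_diff] unchanged, so both mixed partials are limits of the
    same quotient by [h ^+ 2]. *)
Lemma hessian_sym U g z :
  open U -> U z -> C2_on U g -> (hessian g z)^T = hessian g z.
Proof.
move=> oU Uz g2; apply/matrixP => i j; rewrite !mxE.
apply/eqP; rewrite -subr_eq0 -normr_le0; apply/ler_addgt0Pr => e e0; rewrite add0r.
have e2 : 0 < e / 2 by rewrite divr_gt0.
have Aij := second_diff_approx i j oU Uz g2 e2.
have Aji := second_diff_approx j i oU Uz g2 e2.
have [h [/= h0 [/= Hij Hji]]] := filter_ex (filterI (nbhs_right_gt 0) (filterI Aij Aji)).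
have dE : second_diff g z i j h = second_diff g z j i h.
  by rewrite /second_diff addrCA; ring.
rewrite -(ler_pM2r (exprn_gt0 2 h0)) -[X in _ * X <= _]gtr0_norm ?exprn_gt0// -normrM.
rewrite (splitr e) [leRHS]mulrDl; apply: le_trans (lerD Hij Hji).
apply: le_trans (ler_normB _ _); rewrite dE.
move: (second_diff _ _ _ _ _) (partial _ _ _) (partial _ _ _) => d a b.
by rewrite le_eqVlt; apply/orP; left; apply/eqP; congr `|_|; ring.
Qed.

End Schwarz.

Section SaddleField.
Context {R : realType} {n m : nat}.
Local Notation E := 'cV[R]_(n + m).
Implicit Types (phi : 'cV[R]_n -> 'cV[R]_m -> R) (U : set E) (z v : E).

(* [saddle_field phi] is [flipy] times the gradient, so its Jacobian [matA + matB] is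
   [flipy] times the Hessian. *)
Definition flipy : 'M[R]_(n + m) := block_mx 1%:M 0 0 (- 1%:M).

Lemma flipyE (v : E) : flipy *m v = col_mx (usubmx v) (- dsubmx v).
Proof. by rewrite -{1}(vsubmxK v) mul_block_col !mul1mx !mul0mx addr0 add0r mulNmx mul1mx. Qed.

Lemma saddle_fieldE phi z : saddle_field phi z = flipy *m gradient (joint phi) z.
Proof. by rewrite flipyE. Qed.

Lemma matABE phi z : matA phi z + matB phi z = flipy *m hessian (joint phi) z.
Proof.
rewrite -[hessian _ _ in RHS]submxK mulmx_block add_block_mx.
by rewrite !mul1mx !mul0mx !addr0 !add0r !mulNmx !mul1mx.
Qed.

Lemma half_addr {k l : nat} (a : 'M[R]_(k, l)) : 2^-1 *: (a + a) = a.
Proof. by rewrite -mulr2n -[a *+ 2]scaler_nat scalerA mulVf ?pnatr_eq0// scale1r. Qed.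

(** Half the commutator of [flipy] and the Hessian; [matBE] is half the anticommutator. Written as
    matrix products, both inherit the continuity of the Hessian. *)
Lemma matAE phi z : matA phi z =
  2^-1 *: (flipy *m hessian (joint phi) z - hessian (joint phi) z *m flipy).
Proof.
rewrite -[hessian _ _ in RHS]submxK !mulmx_block opp_block_mx add_block_mx scale_block_mx.
rewrite !mul1mx !mul0mx !mulmx0 !mulmx1 !mulNmx !mulmxN !mul1mx !mulmx1 !addr0 !add0r.
rewrite !opprK !subrr !scaler0 addNr scaler0.
by rewrite half_addr -opprD scalerN half_addr.
Qed.

Lemma matBE phi z : matB phi z =
  2^-1 *: (flipy *m hessian (joint phi) z + hessian (joint phi) z *m flipy).
Proof.
rewrite -[hessian _ _ in RHS]submxK !mulmx_block add_block_mx scale_block_mx.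
rewrite !mul1mx !mul0mx !mulmx0 !mulmx1 !mulNmx !mulmxN !mul1mx !mulmx1 !addr0 !add0r.
by rewrite !subrr !addNr !scaler0 half_addr -opprD scalerN half_addr.
Qed.

Lemma matA_skew U phi z : open U -> U z -> C2_on U (joint phi) ->
  (matA phi z)^T = - matA phi z.
Proof.
move=> oU Uz g2; have H := hessian_sym oU Uz g2.
rewrite /matA tr_block_mx opp_block_mx !trmx0 !oppr0 linearN/= opprK.
by rewrite /phi_yx /phi_xy trmx_ursub trmx_dlsub H.
Qed.

Lemma matB_sym U phi z : open U -> U z -> C2_on U (joint phi) ->
  (matB phi z)^T = matB phi z.
Proof.
move=> oU Uz g2; have H := hessian_sym oU Uz g2.
rewrite /matB tr_block_mx !trmx0 linearN/=.
by rewrite /phi_xx /phi_yy trmx_ulsub trmx_drsub H.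
Qed.

Lemma cvg_gradient {T : Type} {F : set_system T} {FF : Filter F} U
    (g : E -> R) (z : T -> E) (l : E) :
  U l -> C1_on U g -> z x @[x --> F] --> l ->
  gradient g (z x) @[x --> F] --> gradient g l.
Proof.
move=> Ul g1 zl; apply: cvg_mx_coord => i j; rewrite mxE.
under eq_cvg do rewrite mxE.
exact: (cvg_comp _ _ zl (g1 i l Ul).2).
Qed.

Lemma cvg_hessian {T : Type} {F : set_system T} {FF : Filter F} U
    (g : E -> R) (z : T -> E) (l : E) :
  U l -> C2_on U g -> z x @[x --> F] --> l ->
  hessian g (z x) @[x --> F] --> hessian g l.
Proof.
move=> Ul [_ g2] zl; apply: cvg_mx_coord => i j; rewrite mxE.
under eq_cvg do rewrite mxE.
exact: (cvg_comp _ _ zl (g2 i j l Ul).2).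
Qed.

Lemma cvg_saddle_field {T : Type} {F : set_system T} {FF : Filter F} U phi
    (z : T -> E) (l : E) :
  U l -> C1_on U (joint phi) -> z x @[x --> F] --> l ->
  saddle_field phi (z x) @[x --> F] --> saddle_field phi l.
Proof.
move=> Ul g1 zl; rewrite saddle_fieldE.
under eq_cvg do rewrite saddle_fieldE.
by apply: cvg_mulmx; [exact: cvg_cst|exact: cvg_gradient Ul g1 zl].
Qed.

Lemma cvg_matAB {T : Type} {F : set_system T} {FF : Filter F} U phi
    (z : T -> E) (l : E) :
  U l -> C2_on U (joint phi) -> z x @[x --> F] --> l ->
  matA phi (z x) @[x --> F] --> matA phi l /\
  matB phi (z x) @[x --> F] --> matB phi l.
Proof.
move=> Ul g2 zl; set H := hessian (joint phi).
have Hl : H (z x) @[x --> F] --> H l by exact: cvg_hessian Ul g2 zl.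
have JH : flipy *m H (z x) @[x --> F] --> flipy *m H l.
  by apply: cvg_mulmx Hl; exact: cvg_cst.
have HJ : H (z x) *m flipy @[x --> F] --> H l *m flipy.
  by apply: cvg_mulmx Hl _; exact: cvg_cst.
split.
  rewrite matAE; under eq_cvg do rewrite matAE.
  by apply: cvgZl_tmp; exact: cvgB JH HJ.
rewrite matBE; under eq_cvg do rewrite matBE.
by apply: cvgZl_tmp; exact: cvgD JH HJ.
Qed.

Lemma is_derive_saddle_field U phi a v (s : R) :
  open U -> U (a + s *: v) -> C2_on U (joint phi) ->
  is_derive s 1 (fun s => saddle_field phi (a + s *: v))
    ((matA phi (a + s *: v) + matB phi (a + s *: v)) *m v).
Proof.
move=> oU Ua [_ g2]; rewrite matABE -mulmxA.
under eq_fun do rewrite saddle_fieldE.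
apply: is_derive_mulmxr; apply: is_derive_mx => i j; rewrite ord1 mxE.
under eq_fun do rewrite mxE.
have := is_derive_along oU Ua (g2 i); rewrite dotE.
by under eq_bigr do rewrite mxE; under [in X in _ -> X]eq_bigr do rewrite mxE.
Qed.

End SaddleField.

(** * Absolutely continuous functions *)

Section AbsolutelyContinuous.
Context {R : realType}.
Implicit Types (h : R -> R) (a b c : R).
Local Notation mu := (@lebesgue_measure R).

(** Scalar counterpart of [absolutely_continuous_on], for squared distances and single
    coordinates. *)
Definition abs_continuous a b h := forall e : R, 0 < e -> exists2 d : R, 0 < d &
  forall k (I : 'I_k -> R * R),
    (forall i, [/\ a <= (I i).1, (I i).1 <= (I i).2 & (I i).2 <= b]) ->
    trivIset setT (fun i => `](I i).1, (I i).2[%classic) ->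
    \sum_i ((I i).2 - (I i).1) < d ->
    \sum_i `|h (I i).2 - h (I i).1| < e.

Lemma sum_length_le (O : set R) k (I : 'I_k -> R * R) :
  open O -> (forall i, (I i).1 <= (I i).2) ->
  (forall i, `](I i).1, (I i).2[%classic `<=` O) ->
  trivIset setT (fun i => `](I i).1, (I i).2[%classic) ->
  ((\sum_i ((I i).2 - (I i).1))%:E <= mu O)%E.
Proof.
move=> oO I12 IO tI.
have mI i : measurable (`](I i).1, (I i).2[%classic : set R) by exact: measurable_itv.
have -> : ((\sum_i ((I i).2 - (I i).1))%:E =
    mu (\big[setU/set0]_(i < k) `](I i).1, (I i).2[%classic))%E.
  rewrite measure_bigsetU_ord//= -sumEFin; apply: eq_bigr => i _.
  rewrite lebesgue_measure_itv/= lte_fin.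
  by have := I12 i; rewrite le_eqVlt => /predU1P[->|->]; rewrite ?ltxx ?subrr.
apply: le_measure; rewrite ?inE//; first exact: bigsetU_measurable.
  exact: measurable_realfun.open_measurable.
by elim/big_ind : _ => [x []|A B AO BO x [/AO|/BO]|i _]//; exact: IO.
Qed.

Lemma derive_gauge h (t l e : R) : is_derive t 1 h l -> 0 < e ->
  exists2 d : R, 0 < d & forall s, `|s - t| < d ->
    `|h s - h t - l * (s - t)| <= e * `|s - t|.
Proof.
move=> /is_deriveP/cvgrPdist_le hl e0; have := hl _ e0.
rewrite near_withinE => /nbhs_ballP[d /= d0 H]; exists d => // s sd.
have [->|st] := eqVneq s t; first by rewrite !subrr mulr0 subrr normr0 mulr0.
have st0 : s - t != 0 by rewrite subr_eq0.
have := H (s - t); rewrite -ball_normE/= sub0r normrN => /(_ sd st0).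
rewrite [_%:A]mulr1 subrK => {}H.
have -> : h s - h t - l * (s - t) = - (l - (s - t)^-1 * (h s - h t)) * (s - t).
  by field.
by rewrite normrM normrN ler_wpM2r.
Qed.

(* Invariant of a continuous induction on [s] (instead of a Vitali covering): the
   exceptional null set lies in a small open [O], where absolute continuity takes over. *)
Definition covered_upto h (O : set R) a c s := exists k (I : 'I_k -> R * R),
  [/\ forall i, [/\ a <= (I i).1, (I i).1 <= (I i).2 & (I i).2 <= s],
      forall i, `](I i).1, (I i).2[%classic `<=` O,
      trivIset setT (fun i => `](I i).1, (I i).2[%classic) &
      h s - h a <= c * (s - a)
        + \sum_i (`|h (I i).2 - h (I i).1| + `|c| * ((I i).2 - (I i).1)) ].

(** The passage from [s] to [s'] is paid for by one more interval: its term in the sum dominates the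
    increment of [h] minus [c * (s' - s)], whatever the sign of [c]. *)
Lemma covered_upto_bad h (O : set R) a c s s' : a <= s -> s <= s' ->
  `[s, s']%classic `<=` O ->
  covered_upto h O a c s -> covered_upto h O a c s'.
Proof.
move=> as_ ss' sO [k [I [Ib IO tI Ih]]].
exists k.+1, (fun i => if unlift ord0 i is Some j then I j else (s, s')); split.
- move=> i; case: unliftP => [j|] _ /=; last by split.
  by have [? ? ?] := Ib j; split => //; exact: le_trans ss'.
- move=> i; case: unliftP => [j|] _ /=; first exact: IO.
  by apply: subset_trans sO; exact: subset_itv_oo_cc.
- have dis j : `](I j).1, (I j).2[%classic `&` `]s, s'[%classic !=set0 -> False.
    have [_ _ Is] := Ib j.
    move=> [x []] /=; rewrite !in_itv/= => /andP[_ xI] /andP[sx _].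
    by have := lt_trans (lt_le_trans xI Is) sx; rewrite ltxx.
  move=> i j _ _; case: unliftP => [i'|] ->; case: unliftP => [j'|] -> //.
  + by move=> H; congr (lift _ _); exact: tI.
  + by move/dis.
  + by rewrite setIC => /dis.
- rewrite big_ord_recl unlift_none/=.
  under eq_bigr do rewrite liftK.
  have -> : h s' - h a = (h s - h a) + (h s' - h s) by ring.
  have -> : c * (s' - a) = c * (s - a) + c * (s' - s) by ring.
  have := ler_norm (h s' - h s); have : - (c * (s' - s)) <= `|c| * (s' - s).
    by rewrite -mulNr ler_wpM2r ?subr_ge0// -normrN ler_norm.
  move: Ih; set S := \sum_i _; lra.
Qed.

Lemma covered_upto_good h (O : set R) a c s s' : s <= s' ->
  h s' - h s <= c * (s' - s) ->
  covered_upto h O a c s -> covered_upto h O a c s'.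
Proof.
move=> ss' hss [k [I [Ib IO tI Ih]]]; exists k, I; split => //.
  by move=> i; have [? ? ?] := Ib i; split => //; exact: le_trans ss'.
have -> : h s' - h a = (h s - h a) + (h s' - h s) by ring.
have -> : c * (s' - a) = c * (s - a) + c * (s' - s) by ring.
by rewrite [leRHS]addrAC lerD.
Qed.

Lemma covered_upto_end h (O : set R) a b c : a <= b -> open O ->
  (forall t, a <= t <= b -> O t \/
     exists2 d, 0 < d & forall s s', a <= s <= t -> t <= s' <= b -> t - d < s -> s' < t + d ->
        h s' - h s <= c * (s' - s)) ->
  covered_upto h O a c b.
Proof.
move=> ab oO H; pose S := [set s | a <= s <= b /\ covered_upto h O a c s].
have Sa : S a.
  split; first by rewrite lexx.
  exists 0%N, (fun _ => (a, a)); split; try by case.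
  by rewrite !subrr mulr0 big_ord0 addr0.
have supS : has_sup S by split; [exists a|exists b => x [/andP[]]].
set t := sup S.
have at_ : a <= t by apply: ub_le_sup => //; exact: supS.2.
have tb : t <= b by apply: ge_sup; [exists a|move=> x [/andP[]]].
have [d d0 step] : exists2 d, 0 < d & forall s s', a <= s <= t -> t <= s' <= b ->
    t - d < s -> s' < t + d -> covered_upto h O a c s -> covered_upto h O a c s'.
  have [|Ot|[d d0 Hd]] := H t; first by rewrite at_.
    have /nbhs_ballP[d /= d0 tO] := open_nbhs_nbhs (conj oO Ot).
    exists d => // s s' /andP[as_ st] /andP[ts' s'b] sd s'd.
    apply: covered_upto_bad => //; first exact: le_trans ts'.
    move=> x /=; rewrite in_itv/= => /andP[sx xs']; apply: tO.
    by rewrite -ball_normE/= ltr_norml; apply/andP; split; lra.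
  exists d => // s s' ast ts'b sd s'd.
  apply: covered_upto_good; last exact: Hd.
  by move: ast ts'b => /andP[_ /le_trans +] /andP[+ _]; apply.
have [s [/andP[as_ sb] Cs] sd] := sup_adherent d0 supS.
have st : s <= t by apply: ub_le_sup; [exact: supS.2|split => //; rewrite as_].
(* One step across the supremum [t]: membership of [s'] in [S] forces [s' <= t], which excludes
   [t + d / 2] and leaves [s' = b]. *)
pose s' := Num.min b (t + d / 2).
have d2 : 0 < d / 2 by rewrite divr_gt0.
have ts' : t <= s' <= b by rewrite le_min tb lerDl (ltW d2) ge_min lexx.
have s'd : s' < t + d.
  by rewrite gt_min; apply/orP; right; rewrite ltrD2l ltr_pdivrMr// mulr2n mulrDr mulr1 ltrDl.
have Cs' : covered_upto h O a c s' by apply: (step s) => //; rewrite as_.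
have s't : s' <= t.
  apply: ub_le_sup; first exact: supS.2.
  by split => //; have /andP[ts'1 ->] := ts'; rewrite (le_trans at_).
move: s't Cs'; rewrite /s'; case: (leP b (t + d / 2)) => [//|_].
by rewrite gerDl leNgt d2.
Qed.

(** Outside a small open set the derivative controls the increments; inside it the intervals of
    [covered_upto] have small total length, and absolute continuity bounds the variation of [h] over
    them. *)
Lemma ae_derive_le h a b c : a <= b -> abs_continuous a b h ->
  {ae mu, forall t : R, a < t < b -> exists2 l, l <= c & is_derive t 1 h l} ->
  h b - h a <= c * (b - a).
Proof.
move=> ab ach hae; apply/ler_addgt0Pr => e e0.
have e30 : 0 < e / 3 by rewrite divr_gt0.
have ba0 : 0 < b - a + 1 by rewrite ltr_wpDl// subr_ge0.
pose e1 := e / 3 / (b - a + 1); have e10 : 0 < e1 by rewrite divr_gt0.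
have [d d0 Hd] := ach _ e30.
(* The error [e] is split in three: the slack [e1] in the slope, the variation of [h] over intervals
   of length below [d], and [|c + e1|] times that length. *)
pose q := Num.min d (e / 3 / (`|c + e1| + 1)).
have q0 : 0 < q by rewrite lt_min d0 divr_gt0// ltr_wpDl.
(* The endpoints join the exceptional set, since the hypothesis on the derivative concerns interior
   times. *)
pose bad := ~` [set t | a < t < b -> exists2 l, l <= c & is_derive t 1 h l]
  `|` ([set a] `|` [set b]).
have bad0 : mu.-negligible bad.
  apply: negligibleU; first exact: hae.
  by apply: negligibleU; apply/negligibleP => //; exact: lebesgue_measure_set1.
have [W [oW bW Wq]] : exists W, [/\ open W, bad `<=` W & (mu W < q%:E)%E].
  have q20 : 0 < q / 2 by rewrite divr_gt0.
  have [Q [oQ badQ Qq]] := outer_measure_open_le bad q20; exists Q; split => //.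
  move: Qq; rewrite (negligible_outer_measure _).1// add0e => /le_lt_trans; apply.
  by rewrite lte_fin ltr_pdivrMr// mulr2n mulrDr mulr1 ltrDl.
have [|k [I [Ib IW tI Ih]]] := @covered_upto_end h W a b (c + e1) ab oW.
  move=> t /andP[at_ tb]; have [Wt|nWt] := pselect (W t); [by left|right].
  have [nbad ta tb'] : [/\ a < t < b -> exists2 l, l <= c & is_derive t 1 h l, t != a & t != b].
    split; [apply: contrapT => H; apply/nWt/bW; by left| |].
      by apply/eqP => ta; apply/nWt/bW; right; left.
    by apply/eqP => ta; apply/nWt/bW; right; right.
  have [|l lc hl] := nbad; first by rewrite !lt_neqAle at_ tb tb' eq_sym ta.
  have [r r0 Hr] := derive_gauge hl e10.
  exists r => // s s' /andP[as_ st] /andP[ts' s'b] rs s'r.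
  have := Hr s'; have := Hr s.
  rewrite !(@ler0_norm _ (s - t)) ?(@ger0_norm _ (s' - t)) ?subr_ge0 ?subr_le0//.
  rewrite !ler_norml => /(_ ltac:(lra))/andP[H1 H2] /(_ ltac:(lra))/andP[H3 H4].
  have : l * (s' - s) <= c * (s' - s) by rewrite ler_wpM2r// subr_ge0 (le_trans st).
  move: H1 H4; rewrite !mulrDl !mulrBr !mulrN; lra.
have Iq : \sum_i ((I i).2 - (I i).1) < q.
  rewrite -lte_fin; apply: le_lt_trans Wq; apply: sum_length_le => // i.
  by have [] := Ib i.
have := Hd k I Ib tI (lt_le_trans Iq _); rewrite ge_min lexx => /(_ isT) Ih2.
have Ih3 : `|c + e1| * \sum_i ((I i).2 - (I i).1) <= e / 3.
  have : \sum_i ((I i).2 - (I i).1) <= e / 3 / (`|c + e1| + 1).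
    by apply: ltW; apply: (lt_le_trans Iq); rewrite ge_min lexx orbT.
  move=> /(ler_wpM2l (normr_ge0 (c + e1)))/le_trans; apply.
  rewrite mulrA ler_pdivrMr ?ltr_wpDl// mulrC ler_wpM2l ?(ltW e30)//.
  by rewrite lerDl.
have e1b : e1 * (b - a) <= e / 3.
  rewrite /e1 mulrAC ler_pdivrMr// ler_wpM2l ?(ltW e30)// lerDl ler01 //.
apply: (le_trans Ih); rewrite big_split/= -mulr_sumr mulrDl; lra.
Qed.

End AbsolutelyContinuous.

(** * Convex sets, faces and projections *)

Section ConvexGeometry.
Context {R : realType} {p : nat}.
Local Notation E := 'cV[R]_p.
Implicit Types (a b c e u v w y z : E) (C K F G S V : set E).

Definition segment_convex C := forall a b (t : R),
  C a -> C b -> 0 <= t <= 1 -> C ((1 - t) *: a + t *: b).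

Lemma convex_set_segment C : convex_set C -> segment_convex C.
Proof.
move=> cC a b t Ca Cb /andP[t0 t1].
have t01 : Itv.spec (Itv.num_sem (R := R)) (Itv.Real `[0%Z, 1%Z]) t.
  by rewrite /Itv.num_sem /= num_real /= in_itv/= t0 t1.
have := cC b a (Itv.mk t01); rewrite !inE => /(_ Cb Ca).
by rewrite /conv/= addrC.
Qed.

Lemma convex_comb0 C : segment_convex C -> C 0 ->
  forall k (f : 'I_k -> E) (t : 'I_k -> R),
  (forall i, C (f i)) -> (forall i, 0 <= t i) -> \sum_i t i <= 1 ->
  C (\sum_i t i *: f i).
Proof.
move=> cC C0; elim=> [|k IH] f t Cf t0 t1; first by rewrite big_ord0.
rewrite big_ord_recl; move: t1; rewrite big_ord_recl => t1.
have S0 : 0 <= \sum_(i < k) t (lift ord0 i) by rewrite sumr_ge0.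
have [t01|t01] := eqVneq (t ord0) 1.
  have /eqP : \sum_(i < k) t (lift ord0 i) = 0.
    by apply/eqP; rewrite eq_le S0 andbT -(lerD2l 1) addr0 -[X in X + _]t01.
  rewrite psumr_eq0// => /allP H; rewrite t01 scale1r big1 ?addr0// => i _.
  by have /eqP -> := H i (mem_index_enum _); rewrite scale0r.
have tn0 : 1 - t ord0 != 0 by rewrite subr_eq0 eq_sym.
have t0lt : 0 < 1 - t ord0.
  by rewrite lt_neqAle eq_sym tn0 subr_ge0 (le_trans _ t1)// lerDl.
have -> : \sum_(i < k) t (lift ord0 i) *: f (lift ord0 i) =
    (1 - t ord0) *: \sum_(i < k) (t (lift ord0 i) / (1 - t ord0)) *: f (lift ord0 i).
  by rewrite scaler_sumr; apply: eq_bigr => i _; rewrite scalerA mulrCA mulfV// mulr1.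
rewrite addrC; apply: cC => //; last by rewrite t0 -subr_ge0 ltW.
apply: IH => //; first by move=> i; rewrite divr_ge0// ltW.
by rewrite -mulr_suml ler_pdivrMr// mul1r lerBrDr addrC.
Qed.

(** Take [M] of maximal rank among the matrices with rows in [C]: appending the row of another point
    of [C] cannot raise the rank. *)
Lemma spanning_rows C : exists k (M : 'M[R]_(k, p)),
  (forall i, C (row i M)^T) /\ forall y, C y -> (y^T <= M)%MS.
Proof.
pose P r := `[< exists k (M : 'M[R]_(k, p)), (forall i, C (row i M)^T) /\ \rank M = r >].
have P0 : exists r, P r.
  exists 0%N; apply/asboolP; exists 0%N, 0; split; first by case.
  by rewrite mxrank0.
have Pp r : P r -> (r <= p)%N by move=> /asboolP[k [M [_ <-]]]; exact: rank_leq_col.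
case: (ex_maxnP P0 Pp) => r /asboolP[k [M [CM rM]]] rmax.
exists k, M; split => // y Cy.
have MS : (M <= col_mx M y^T)%MS by rewrite -addsmxE addsmxSl.
have : \rank M = \rank (col_mx M y^T).
  apply/eqP; rewrite eqn_leq mxrankS//= rM; apply: rmax; apply/asboolP.
  exists (k + 1)%N, (col_mx M y^T); split => // i.
  case: (split_ordP i) => j ->; first by rewrite rowKu.
  by rewrite rowKd row_id trmxK.
move/eqP; rewrite (mxrank_leqif_sup MS).
by apply: submx_trans; rewrite -addsmxE addsmxSr.
Qed.

(* Such a [c] lies in the relative interior of [C]; the margin is uniform on bounded sets. *)
Lemma relint_point C : segment_convex C -> C 0 -> exists2 c, C c &
  forall B : R, exists2 d : R, 0 < d &
    forall y, C y -> dot y y <= B -> C (c + d *: (c - y)).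
Proof.
move=> cC C0; have [k [M [CM Msp]]] := spanning_rows C.
pose f (i : 'I_k) : E := (row i M)^T.
(* The barycenter of 0 and the [k] spanning points; the weight [kk] left on 0 is the slack that
   keeps the perturbed weights summing to at most 1. *)
pose kk : R := k.+1%:R^-1; have kk0 : 0 < kk by rewrite invr_gt0.
have kk1 : k%:R * kk + kk = 1 by rewrite -[X in _ + X]mul1r -mulrDl natr1 mulfV ?pnatr_eq0.
exists (\sum_i kk *: f i).
  apply: convex_comb0 => //; first by move=> i; rewrite ltW.
  by rewrite sumr_const card_ord -mulr_natl -[leRHS]kk1 lerDl ltW.
move=> B.
pose A := 1 + Num.max 0 B.
have A1 : 1 <= A by rewrite /A lerDl le_max lexx.
have A0 : 0 <= A by rewrite (le_trans ler01).
have A2 : B <= A ^+ 2.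
  rewrite (@le_trans _ _ A)//; first by rewrite /A ler_wpDl// le_max lexx orbT.
  by rewrite expr2 ler_peMr.
pose T := \sum_i `|col i (pinvmx M)|.
have T0 : 0 <= T by rewrite sumr_ge0.
pose L := p%:R * (A * T).
have L0 : 0 <= L by rewrite !mulr_ge0.
have E0 : 0 < 1 + (k%:R + 1) * L by rewrite ltr_wpDr// mulr_ge0// addr_ge0.
(* [L] bounds the coordinates of [y] in the spanning points. Then [d * L <= kk] keeps each new
   weight nonnegative and [d * (1 + k%:R * L) <= kk] keeps their sum below 1. *)
have [d d0 dL] : exists2 d, 0 < d & d * (1 + (k%:R + 1) * L) = kk.
  by exists (kk / (1 + (k%:R + 1) * L)); [rewrite divr_gt0|rewrite divfK// gt_eqF].
exists d => // y Cy yB.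
pose r := y^T *m pinvmx M.
have yE : y = \sum_i r 0 i *: f i.
  apply: trmx_inj; rewrite -(mulmxKpV (Msp _ Cy)) -/r mulmx_sum_row linear_sum/=.
  by apply: eq_bigr => i _; rewrite linearZ/= trmxK.
have rL i : `|r 0 i| <= L.
  have -> : r 0 i = dot y (col i (pinvmx M)).
    by rewrite /r mxE dotE; apply: eq_bigr => j _; rewrite !mxE.
  rewrite (le_trans (norm_dot_le _ _))// ler_wpM2l// ler_pM//.
    rewrite -(ler_pXn2r (ltn0Sn 1)) ?nnegrE// (le_trans (sqr_norm_le_dot _))//.
    exact: le_trans yB A2.
  by rewrite /T (bigD1 i)//= lerDl sumr_ge0.
have -> : \sum_i kk *: f i + d *: (\sum_i kk *: f i - y) =
    \sum_i (kk + d * (kk - r 0 i)) *: f i.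
  rewrite [in LHS]yE -sumrB scaler_sumr -big_split/=; apply: eq_bigr => i _.
  by rewrite -scalerBl scalerA -scalerDl.
apply: convex_comb0 => // [i|].
  have := rL i; rewrite ler_norml => /andP[r1 r2].
  have : d * r 0 i <= d * L by rewrite ler_wpM2l// ltW.
  have : 0 <= d * (k%:R * L) by rewrite !mulr_ge0// ltW.
  have : 0 <= d * kk by rewrite mulr_ge0// ltW.
  lra.
have : - \sum_i r 0 i <= k%:R * L.
  rewrite -sumrN mulr_natl -[X in _ *+ X]card_ord -sumr_const ler_sum// => i _.
  by have := rL i; rewrite ler_norml => /andP[]; lra.
move=> rk; have : d * - \sum_i r 0 i <= d * (k%:R * L) by rewrite ler_wpM2l// ltW.
rewrite big_split/= -mulr_sumr sumrB !sumr_const card_ord -[kk *+ k]mulr_natl.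
have : 0 <= d * L by rewrite mulr_ge0// ltW.
have : d * (k%:R * kk) = d - d * kk.
  by rewrite (_ : k%:R * kk = 1 - kk) ?mulrBr ?mulr1// -[X in X - _]kk1 addrK.
have : 0 <= d * kk by rewrite mulr_ge0// ltW.
lra.
Qed.

End ConvexGeometry.

(** * Faces, affine spans and the projection onto them *)

Section Faces.
Context {R : realType} {p : nat}.
Local Notation E := 'cV[R]_p.
Implicit Types (a b c e u v w y z : E) (C K F G S V : set E).

Lemma segmentP a b c : segment a b c <-> exists2 t : R, 0 <= t <= 1 & c = (1 - t) *: a + t *: b.
Proof.
split=> [[t /=]|[t t01 ->]]; first by rewrite in_itv/= => t01 <-; exists t.
by exists t => //=; rewrite in_itv.
Qed.

Lemma segment_sub K a b : segment_convex K -> K a -> K b -> segment a b `<=` K.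
Proof. by move=> cK Ka Kb c /segmentP[t t01 ->]; exact: cK. Qed.

Lemma segment_l a b : segment a b a.
Proof. by apply/segmentP; exists 0; rewrite ?lexx ?ler01// subr0 scale1r scale0r addr0. Qed.

Lemma segment_r a b : segment a b b.
Proof. by apply/segmentP; exists 1; rewrite ?lexx ?ler01// subrr scale1r scale0r add0r. Qed.

(* This is the minimal face of [K] containing [e]. *)
Definition opposite_extends K e : set E :=
  [set w | K w /\ exists2 d : R, 0 < d & K (e + d *: (e - w))].

Lemma opposite_extends_shrink K e w (d d' : R) : segment_convex K -> K e ->
  0 <= d' <= d -> 0 < d -> K (e + d *: (e - w)) -> K (e + d' *: (e - w)).
Proof.
move=> cK Ke /andP[d'0 d'd] d0 Kd.
have -> : e + d' *: (e - w) = (1 - d' / d) *: e + (d' / d) *: (e + d *: (e - w)).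
  by apply/colP => i; rewrite !mxE; field; rewrite gt_eqF.
by apply: (cK) => //; rewrite divr_ge0// ?(ltW d0)// ler_pdivrMr// mul1r.
Qed.

(** Planar geometry: extending from [a] through [e] meets the segment that joins [b] to the
    extension, through [e], of the interior point. *)
Lemma opposite_extends_end K e a b (t : R) : segment_convex K ->
  0 < t < 1 -> segment a b `<=` K ->
  opposite_extends K e ((1 - t) *: a + t *: b) -> opposite_extends K e a.
Proof.
move=> cK /andP[t0 t1] abK [_ [d d0 Kd]]; split; first exact/abK/segment_l.
have dt : 0 < 1 + d * t by rewrite ltr_wpDr// mulr_ge0// ltW.
exists (d * (1 - t) / (1 + d * t)); first by rewrite divr_gt0// mulr_gt0// subr_gt0.
have -> : e + (d * (1 - t) / (1 + d * t)) *: (e - a) =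
    (1 - d * t / (1 + d * t)) *: (e + d *: (e - ((1 - t) *: a + t *: b)))
    + (d * t / (1 + d * t)) *: b.
  by apply/colP => i; rewrite !mxE; field; rewrite gt_eqF.
apply: (cK) => //; first exact/abK/segment_r.
by rewrite divr_ge0 ?(ltW dt) ?mulr_ge0 ?(ltW d0) ?(ltW t0)//= ler_pdivrMr// mul1r lerDr.
Qed.

Lemma opposite_extends_convex K e : segment_convex K -> K e ->
  segment_convex (opposite_extends K e).
Proof.
move=> cK Ke a b t [Ka [d d0 Kd]] [Kb [d' d'0 Kd']] t01; split; first exact: cK.
pose q := Num.min d d'; have q0 : 0 < q by rewrite lt_min d0.
exists q => //.
have -> : e + q *: (e - ((1 - t) *: a + t *: b)) =
    (1 - t) *: (e + q *: (e - a)) + t *: (e + q *: (e - b)).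
  by apply/colP => i; rewrite !mxE; ring.
apply: (cK) => //.
  by apply: (opposite_extends_shrink cK Ke _ d0 Kd); rewrite (ltW q0) ge_min lexx.
by apply: (opposite_extends_shrink cK Ke _ d'0 Kd'); rewrite (ltW q0) ge_min lexx orbT.
Qed.

Lemma segment_convexW C : segment_convex C -> convex_set C.
Proof.
move=> cC a b t; rewrite !inE => Ca Cb.
have := cC b a t%:num Cb Ca; rewrite ge0 le1 => /(_ isT).
by rewrite /conv/= addrC.
Qed.

Lemma is_face_opposite_extends K e : segment_convex K -> K e ->
  is_face K (opposite_extends K e).
Proof.
move=> cK Ke; split; first by move=> w [].
  exact/segment_convexW/opposite_extends_convex.
move=> a b abK [w [[t /=]]]; rewrite in_itv/= => /andP[t0 t1] <- Hw.
apply: segment_sub; first exact: opposite_extends_convex.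
  by apply: opposite_extends_end Hw => //; rewrite t0.
have ba : segment b a `<=` K.
  by apply: segment_sub => //; apply: abK; [exact: segment_r|exact: segment_l].
have H : opposite_extends K e ((1 - (1 - t)) *: b + (1 - t) *: a).
  by move: Hw; congr opposite_extends; apply/colP => i; rewrite !mxE; ring.
apply: opposite_extends_end H => //; rewrite subr_gt0 t1/=; lra.
Qed.

Lemma minimal_face_sub_opposite K e S : segment_convex K -> K e ->
  S `<=` opposite_extends K e -> minimal_face K S `<=` opposite_extends K e.
Proof. by move=> cK Ke SG w; apply; split => //; exact: is_face_opposite_extends. Qed.

Lemma sub_minimal_face K S : S `<=` minimal_face K S.
Proof. by move=> w Sw F [_]; exact. Qed.

(** The point [s] is interior to the segment from [y] to its extension through [s], so every face
    that contains [s] contains [y]. *)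
Lemma minimal_face_extend K S s y (d : R) : segment_convex K -> S s -> K y -> 0 < d ->
  K (s + d *: (s - y)) -> minimal_face K S y.
Proof.
move=> cK Ss Ky d0 Kq F [[_ _ Fseg] SF].
have yq : segment y (s + d *: (s - y)) `<=` K by exact: segment_sub.
apply: (Fseg _ _ yq); last exact: segment_l.
exists s; split; last exact: SF.
have d1 : 0 < 1 + d by rewrite ltr_wpDr// ltW.
exists (1 + d)^-1; first by rewrite /= in_itv/= invr_gt0 d1 invf_lt1// ltrDl.
by apply/colP => i; rewrite !mxE; field; rewrite gt_eqF.
Qed.

Lemma is_affine_span S : is_affine (affine_span S).
Proof. by move=> a b t Sa Sb W WS; apply: WS.1; [exact: Sa|exact: Sb]. Qed.

Lemma sub_affine_span S : S `<=` affine_span S.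
Proof. by move=> w Sw W [_]; exact. Qed.

(** The lineality space of the cone of feasible directions of [K] at [e]; for convex [K] containing
    [e] it is a linear subspace. *)
Definition two_sided K e : set E :=
  [set v | exists2 s : R, 0 < s & K (e + s *: v) /\ K (e - s *: v)].

Lemma two_sided_scale K e v (k : R) : segment_convex K -> K e ->
  two_sided K e v -> two_sided K e (k *: v).
Proof.
move=> cK Ke [s s0 [Kp Km]].
have k0 : 0 < `|k| + 1 by rewrite ltr_wpDl.
exists (s / (`|k| + 1)); first by rewrite divr_gt0.
pose t := (1 + k / (`|k| + 1)) / 2.
have kk : - 1 <= k / (`|k| + 1) <= 1.
  rewrite ler_pdivlMr// ler_pdivrMr// mul1r mulN1r.
  by have := ler_norm k; have := ler_norm (- k); rewrite normrN; lra.
have t01 : 0 <= t <= 1 by rewrite /t; lra.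
have conv (r : R) : 0 <= r <= 1 -> K (e + (s * (2 * r - 1)) *: v).
  move=> r01; have := cK _ _ r Km Kp r01.
  by congr K; apply/colP => i; rewrite !mxE; ring.
split.
  have := conv t t01; congr K; apply/colP => i; rewrite !mxE /t.
  by field; rewrite gt_eqF.
have := conv (1 - t); have -> : 0 <= 1 - t <= 1 by lra.
move=> /(_ isT); congr K; apply/colP => i; rewrite !mxE /t.
by field; rewrite gt_eqF.
Qed.

Lemma two_sided_add K e v w : segment_convex K ->
  two_sided K e v -> two_sided K e w -> two_sided K e (v + w).
Proof.
move=> cK [s s0 [Kp Km]] [s' s'0 [Kp' Km']].
have ss : 0 < s + s' by rewrite addr_gt0.
exists (s * s' / (s + s')); first by rewrite divr_gt0// mulr_gt0.
have t01 : 0 <= s / (s + s') <= 1.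
  by rewrite divr_ge0 ?(ltW s0) ?(ltW ss)//= ler_pdivrMr// mul1r lerDl ltW.
split.
  have := cK _ _ (s / (s + s')) Kp Kp' t01; congr K.
  by apply/colP => i; rewrite !mxE; field; rewrite gt_eqF.
have := cK _ _ (s / (s + s')) Km Km' t01; congr K.
by apply/colP => i; rewrite !mxE; field; rewrite gt_eqF.
Qed.

(** Differences [w - e] with [w] in [F] are two-sided directions. As 0 lies in [F], so is [e]
    itself, which turns directions relative to [e] into points of the span. *)
Lemma affine_span_two_sided K e F : segment_convex K -> K e ->
  F `<=` opposite_extends K e -> F 0 -> affine_span F `<=` two_sided K e.
Proof.
move=> cK Ke FG F0.
have sub w : F w -> two_sided K e (w - e).
  move=> /FG[Kw [d d0 Kd]].
  have d1 : 0 < 1 + d by rewrite ltr_wpDr// ltW.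
  exists (d / (1 + d)); first by rewrite divr_gt0.
  have q1 : d / (1 + d) <= 1 by rewrite ler_pdivrMr// mul1r lerDr ler01.
  have q0 : 0 <= d / (1 + d) by rewrite divr_ge0 ?(ltW d0) ?(ltW d1).
  split.
    have := cK _ _ (d / (1 + d)) Ke Kw; rewrite q0 q1 => /(_ isT); congr K.
    by apply/colP => i; rewrite !mxE; ring.
  rewrite -scalerN opprB; apply: (opposite_extends_shrink cK Ke _ d0 Kd).
  by rewrite q0 ler_pdivrMr// mulrDr mulr1 lerDl mulr_ge0// ltW.
have Ue : two_sided K e e.
  by have := two_sided_scale (-1) cK Ke (sub _ F0); rewrite sub0r scaleN1r opprK.
move=> v Vv; rewrite -(subrK e v); apply: two_sided_add => //.
apply: (Vv [set v | two_sided K e (v - e)]); split; last by move=> w Fw; exact: sub.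
move=> a b t /= Ua Ub.
have -> : (1 - t) *: a + t *: b - e = (1 - t) *: (a - e) + t *: (b - e).
  by apply/colP => i; rewrite !mxE; ring.
by apply: two_sided_add => //; exact: two_sided_scale.
Qed.

(** A linear form that is nonpositive at [w] and at the extension of [w] through [e], and zero at
    [e], is zero at [w]. *)
Lemma normal_orth_affine_span K e z n F : K z ->
  normal_cone K z n -> dot n (e - z) = 0 -> dot n e = 0 ->
  F `<=` opposite_extends K e -> forall v, affine_span F v -> dot n v = 0.
Proof.
move=> Kz nz ez e0 FG v Vv.
have z0 : dot n z = 0.
  by move: ez; rewrite dotDr dotNr e0 add0r => /eqP; rewrite oppr_eq0 => /eqP.
apply: (Vv [set v | dot n v = 0]); split.
  by move=> a b t /= na nb; rewrite !dot_lin na nb !mulr0 addr0.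
move=> w /FG[Kw [d d0 Kd]] /=.
have := nz _ Kw; have := nz _ Kd; rewrite !dot_lin z0 e0 subr0 sub0r add0r mulrN.
rewrite oppr_le0 subr0 pmulr_rge0// => w0 w1.
by apply/eqP; rewrite eq_le w0 w1.
Qed.

Section LinearSpan.
Variable V : set E.
Hypotheses (aV : is_affine V) (V0 : V 0).

Lemma affine0_scale k v : V v -> V (k *: v).
Proof. by move=> Vv; have := aV k V0 Vv; rewrite scaler0 add0r. Qed.

Lemma affine0_add u v : V u -> V v -> V (u + v).
Proof.
move=> Vu Vv; have := affine0_scale 2 (aV 2^-1 Vu Vv); congr V.
by apply/colP => i; rewrite !mxE; field.
Qed.

Lemma affine0_sum k (f : 'I_k -> E) : (forall i, V (f i)) -> V (\sum_i f i).
Proof. by move=> Vf; elim/big_ind : _ => // *; exact: affine0_add. Qed.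

Lemma affine_normal_coneP n : affine_normal_cone V n <-> forall v, V v -> dot n v = 0.
Proof.
split=> [nV v Vv|n0 z Vz z' Vz']; last by rewrite dotDr dotNr !n0// subrr.
have := nV 0 V0 v Vv; have := nV v Vv 0 V0; rewrite subr0 sub0r dotNr oppr_le0 => v0 v1.
by apply/eqP; rewrite eq_le v0 v1.
Qed.

(** With the rows of [M] spanning [V], the row space of [M] and the kernel of [M^T] meet trivially,
    as a common vector is orthogonal to itself, and their ranks add up to [p]. *)
Lemma orth_decomp a : exists v n, [/\ V v, affine_normal_cone V n & a = v + n].
Proof.
have [k [M [VM Msp]]] := spanning_rows V.
have memM (u : 'rV[R]_k) : V (u *m M)^T.
  rewrite mulmx_sum_row linear_sum/=; apply: affine0_sum => i.
  by rewrite linearZ/=; exact: affine0_scale.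
have cap0 : (M :&: kermx M^T)%MS = 0.
  apply/eqP; rewrite -submx0; apply/rV_subP => u; rewrite sub_capmx => /andP[/submxP[c uc]].
  move=> /sub_kermxP uM; suff -> : u = 0 by exact: sub0mx.
  apply: trmx_inj; rewrite trmx0; apply: dot_eq0.
  rewrite /dot trmxK {2}uc trmx_mul mulmxA uM mul0mx mxE; reflexivity.
have full : (1%:M <= M + kermx M^T)%MS.
  rewrite sub1mx /row_full; apply/eqP.
  have := mxrank_sum_cap M (kermx M^T); rewrite cap0 mxrank0 addn0 => ->.
  by rewrite mxrank_ker mxrank_tr subnKC// rank_leq_col.
have /sub_addsmxP[[u1 u2]/= aE] : (a^T <= M + kermx M^T)%MS.
  exact: submx_trans (submx1 _) full.
exists (u1 *m M)^T, (u2 *m kermx M^T)^T; split => //.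
  apply/affine_normal_coneP => v Vv.
  have /submxP[c vc] := Msp _ Vv.
  rewrite /dot trmxK -[v]trmxK vc trmx_mul mulmxA -(mulmxA u2) mulmx_ker mulmx0 mul0mx.
  by rewrite mxE.
by rewrite -linearD/= -aE trmxK.
Qed.

(** A double orthogonal complement; hence [Pi] below is the orthogonal projection onto [V]
    itself. *)
Lemma orth_complement_normal : orth_complement (affine_normal_cone V) = V.
Proof.
apply/seteqP; split=> [w Ww|v Vv n nN]; last first.
  by rewrite dotC; move/affine_normal_coneP : nN; exact.
have [v [n [Vv nN wE]]] := orth_decomp w.
have n0 : n = 0.
  apply: dot_eq0; move/affine_normal_coneP : (nN) => /(_ v Vv); rewrite dotC => vn.
  by have := Ww n nN; rewrite wE dotDl vn add0r.
by rewrite wE n0 addr0.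
Qed.

Lemma dot_pythagoras u w : dot u w = 0 ->
  dot (u + w) (u + w) = dot u u + dot w w.
Proof. by move=> uw; rewrite dotDl !dotDr (dotC w u) uw addr0 add0r. Qed.

Lemma euclidean_proj_orth v n : V v -> affine_normal_cone V n ->
  euclidean_proj V (v + n) = v.
Proof.
move=> Vv /affine_normal_coneP nN.
have dist q : V q -> dot (v + n - q) (v + n - q) = dot n n + dot (v - q) (v - q).
  move=> Vq; have -> : v + n - q = n + (v - q) by rewrite addrAC addrC.
  by rewrite dot_pythagoras// dotDr dotNr !nN// subrr.
apply: xget_unique.
  by split=> // q Vq; rewrite euclidean_norm_le !dist// subrr dot0l addr0 lerDl dot_ge0.
move=> q [Vq /(_ v Vv)]; rewrite euclidean_norm_le !dist// subrr dot0l addr0 gerDl.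
by move=> /dot_le0/eqP; rewrite subr_eq0 eq_sym => /eqP.
Qed.

Variable Pi : 'M[R]_p.
Hypothesis PiE : forall v, Pi *m v = euclidean_proj (orth_complement (affine_normal_cone V)) v.

Lemma proj_id v : V v -> Pi *m v = v.
Proof.
move=> Vv; rewrite PiE orth_complement_normal -[v in LHS]addr0 euclidean_proj_orth//.
by apply/affine_normal_coneP => w _; rewrite dot0l.
Qed.

Lemma proj_normal n : affine_normal_cone V n -> Pi *m n = 0.
Proof. by move=> nN; rewrite PiE orth_complement_normal -[n]add0r euclidean_proj_orth. Qed.

Lemma proj_mem a : V (Pi *m a).
Proof.
have [v [n [Vv nN ->]]] := orth_decomp a.
by rewrite mulmxDr (proj_id Vv) (proj_normal nN) addr0.
Qed.

Lemma proj_sym : Pi^T = Pi.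
Proof.
have sym a b : dot (Pi *m a) b = dot a (Pi *m b).
  have [v [n [Vv nN ->]]] := orth_decomp a; have [w [q [Vw qN ->]]] := orth_decomp b.
  rewrite !mulmxDr (proj_id Vv) (proj_id Vw) (proj_normal nN) (proj_normal qN).
  rewrite !addr0 dotDl dotDr.
  move/affine_normal_coneP : nN => ->//; rewrite addr0.
  by rewrite (dotC v q); move/affine_normal_coneP : qN => ->//; rewrite addr0.
apply/matrixP => i j.
have : Pi^T *m delta_mx j 0 = Pi *m delta_mx j 0 :> E.
  by apply: eq_dot => a; rewrite -sym dot_mulmx.
by move=> /(congr1 (fun M : E => M i 0)); rewrite -!colE !mxE.
Qed.

End LinearSpan.
End Faces.

(** * Saddle points and monotonicity *)

Section SaddleInequalities.
Context {R : realType} {n m : nat}.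
Local Notation E := 'cV[R]_(n + m).
Variables (Kx : set 'cV[R]_n) (Ky : set 'cV[R]_m) (phi : 'cV[R]_n -> 'cV[R]_m -> R).
Let K := product_set Kx Ky.
Local Notation f := (saddle_field phi).
Hypotheses (cKx : convex_set Kx) (cKy : convex_set Ky).
Hypotheses (phi2 : C2_near K (joint phi)) (phicc : concave_convex_on Kx Ky phi).
Implicit Types (z w e v : E).

Lemma segment_convex_product : segment_convex K.
Proof.
move=> a b t [ax ay] [bx by_] t01; split; rewrite !linearD !linearZ/=.
  by apply: convex_set_segment.
by apply: convex_set_segment.
Qed.

Lemma is_derive_le_slope (k : R -> R) (l c : R) : is_derive (0 : R) 1 k l ->
  (forall s, 0 < s <= 1 -> k s - k 0 <= c * s) -> l <= c.
Proof.
move=> kl kc; apply/ler_addgt0Pr => e e0.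
have [d d0 Hd] := derive_gauge kl e0.
pose s := Num.min 1 (d / 2).
have s0 : 0 < s by rewrite lt_min ltr01 divr_gt0.
have sd : s < d by rewrite gt_min ltr_pdivrMr// mulr2n mulrDr mulr1 ltrDl d0 orbT.
have := Hd s; rewrite subr0 (gtr0_norm s0) => /(_ sd); rewrite ler_norml => /andP[H _].
have := kc s; rewrite s0 ge_min lexx => /(_ isT) H'.
rewrite -(ler_pM2r s0); lra.
Qed.

Lemma is_derive_joint z v : K z ->
  is_derive (0 : R) 1 (fun s : R => joint phi (z + s *: v)) (dot (gradient (joint phi) z) v).
Proof.
move=> Kz; have [U [oU KU [g1 _]]] := phi2.
have := @is_derive_along _ _ U (joint phi) z v 0 oU.
by rewrite scale0r addr0; apply => //; exact: KU.
Qed.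

Definition xpart v : E := col_mx (usubmx v) 0.
Definition ypart v : E := col_mx 0 (dsubmx v).

Lemma dot_saddle_field z v : dot (f z) v =
  dot (gradient (joint phi) z) (xpart v) - dot (gradient (joint phi) z) (ypart v).
Proof.
rewrite saddle_fieldE dot_mulmx.
have -> : flipy^T *m v = xpart v - ypart v.
  rewrite /flipy tr_block_mx !trmx0 linearN/= !trmx1 -/flipy flipyE.
  by rewrite opp_col_mx add_col_mx subr0 add0r.
by rewrite dotDr dotNr.
Qed.

Lemma joint_xpart z v (s : R) :
  joint phi (z + s *: xpart v) = phi (usubmx z + s *: usubmx v) (dsubmx z).
Proof. by rewrite /joint !linearD !linearZ/= col_mxKu col_mxKd scaler0 addr0. Qed.

Lemma joint_ypart z v (s : R) :
  joint phi (z + s *: ypart v) = phi (usubmx z) (dsubmx z + s *: dsubmx v).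
Proof. by rewrite /joint !linearD !linearZ/= col_mxKu col_mxKd scaler0 addr0. Qed.

Lemma convex_function_le {q : nat} (C : set 'cV[R]_q) (g : 'cV[R]_q -> R) a b (t : R) :
  convex_function C g -> C a -> C b -> 0 <= t <= 1 ->
  g (a + t *: (b - a)) <= (1 - t) * g a + t * g b.
Proof.
move=> cg Ca Cb /andP[t0 t1].
have t01 : Itv.spec (Itv.num_sem (R := R)) (Itv.Real `[0%Z, 1%Z]) t.
  by rewrite /Itv.num_sem /= num_real /= in_itv/= t0 t1.
have := cg (Itv.mk t01) b a; rewrite !inE => /(_ Cb Ca).
have -> : a + t *: (b - a) = t *: b + (1 - t) *: a.
  by apply/colP => i; rewrite !mxE; ring.
by rewrite [leRHS]addrC; apply.
Qed.

(** The gradient inequalities of the concave and of the convex variable, added. The left side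
    changes sign when [z] and [w] are exchanged, so that two instances give monotonicity. *)
Lemma saddle_field_ge z w : K z -> K w ->
  phi (usubmx w) (dsubmx z) - phi (usubmx z) (dsubmx w) <= dot (f z) (w - z).
Proof.
move=> Kz Kw; rewrite dot_saddle_field.
have [Kzx Kzy] := Kz; have [Kwx Kwy] := Kw.
have Hx : - dot (gradient (joint phi) z) (xpart (w - z)) <=
    phi (usubmx z) (dsubmx z) - phi (usubmx w) (dsubmx z).
  apply: (is_derive_le_slope (is_deriveN (is_derive_joint (xpart (w - z)) Kz)))
    => s /andP[s0 s1].
  rewrite -![(- _ : _ -> _) _]/(- _) !joint_xpart scale0r addr0 linearB/=.
  have := convex_function_le (phicc.1 _ Kzy) Kzx Kwx (t := s); rewrite (ltW s0) s1 => /(_ isT).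
  by lra.
have Hy : dot (gradient (joint phi) z) (ypart (w - z)) <=
    phi (usubmx z) (dsubmx w) - phi (usubmx z) (dsubmx z).
  apply: (is_derive_le_slope (is_derive_joint (ypart (w - z)) Kz)) => s /andP[s0 s1].
  rewrite !joint_ypart scale0r addr0 linearB/=.
  have := convex_function_le (phicc.2 _ Kzx) Kzy Kwy (t := s); rewrite (ltW s0) s1 => /(_ isT).
  by lra.
lra.
Qed.

Lemma saddle_field_mono z w : K z -> K w -> dot (f z - f w) (z - w) <= 0.
Proof.
move=> Kz Kw; have := saddle_field_ge Kz Kw; have := saddle_field_ge Kw Kz.
move: (f z) (f w) (phi _ _) (phi _ _) => a b c d.
by rewrite !dotDr !dotNr !dotDl !dotNl; lra.
Qed.

(** First-order optimality. One direction differentiates along segments in each factor of the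
    product; the other applies [saddle_field_ge] to points that differ from [e] in one block. *)
Lemma restricted_saddleP e :
  restricted_saddle K phi e <-> K e /\ normal_cone K e (f e).
Proof.
split=> [[Ke es]|[Ke ne]]; split => //.
  move=> w Kw; have [Kwx Kwy] := Kw; have [Kex Key] := Ke.
  rewrite dot_saddle_field.
  have cK := segment_convex_product.
  have Hx : dot (gradient (joint phi) e) (xpart (w - e)) <= 0.
    apply: (is_derive_le_slope (is_derive_joint (xpart (w - e)) Ke)) => s /andP[s0 s1].
    rewrite mul0r subr_le0 !joint_xpart scale0r addr0 linearB/=.
    have Kc : Kx (usubmx e + s *: (usubmx w - usubmx e)).
      have := convex_set_segment cKx (t := s) Kex Kwx; rewrite (ltW s0) s1.
      move=> /(_ isT); congr Kx.
      by apply/colP => i; rewrite !mxE; ring.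
    have H1 : K (col_mx (usubmx e + s *: (usubmx w - usubmx e)) (dsubmx e)).
      by split; rewrite ?col_mxKu ?col_mxKd.
    have H2 : K (col_mx (usubmx e) (dsubmx e)) by split; rewrite ?col_mxKu ?col_mxKd.
    by have /andP[] := es _ _ H1 H2.
  have Hy : - dot (gradient (joint phi) e) (ypart (w - e)) <= 0.
    apply: (is_derive_le_slope (is_deriveN (is_derive_joint (ypart (w - e)) Ke)))
      => s /andP[s0 s1].
    rewrite -![(- _ : _ -> _) _]/(- _) mul0r opprK addrC subr_le0 !joint_ypart.
    rewrite scale0r addr0 linearB/=.
    have Kc : Ky (dsubmx e + s *: (dsubmx w - dsubmx e)).
      have := convex_set_segment cKy (t := s) Key Kwy; rewrite (ltW s0) s1.
      move=> /(_ isT); congr Ky.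
      by apply/colP => i; rewrite !mxE; ring.
    have H1 : K (col_mx (usubmx e) (dsubmx e)) by split; rewrite ?col_mxKu ?col_mxKd.
    have H2 : K (col_mx (usubmx e) (dsubmx e + s *: (dsubmx w - dsubmx e))).
      by split; rewrite ?col_mxKu ?col_mxKd.
    by have /andP[] := es _ _ H1 H2.
  lra.
move=> x y Kx' Ky'.
have := saddle_field_ge Ke Kx'; have := saddle_field_ge Ke Ky'.
have := ne _ Kx'; have := ne _ Ky'.
by rewrite !col_mxKu !col_mxKd; lra.
Qed.

End SaddleInequalities.

(** * Energy estimates for absolutely continuous curves *)

Section Energy.
Context {R : realType} {p : nat}.
Local Notation E := 'cV[R]_p.
Local Notation mu := (@lebesgue_measure R).
Implicit Types (z w : R -> E).

Lemma ae_sub (P Q : R -> Prop) : (forall t, P t -> Q t) ->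
  {ae mu, forall t, P t} -> {ae mu, forall t, Q t}.
Proof. by move=> PQ; apply: negligibleS => t /= nQ Pt; apply: nQ; exact: PQ. Qed.

Lemma ae_and (P Q : R -> Prop) :
  {ae mu, forall t, P t} -> {ae mu, forall t, Q t} -> {ae mu, forall t, P t /\ Q t}.
Proof.
move=> aP aQ; have := negligibleU aP aQ; apply: negligibleS => t /= nPQ.
have [Pt|nP] := pselect (P t); last by left.
by right => Qt; apply: nPQ.
Qed.

Lemma abs_continuous_uniform a b z : absolutely_continuous_on a b z ->
  forall e : R, 0 < e -> exists2 d : R, 0 < d &
    forall s t, a <= s <= b -> a <= t <= b -> `|s - t| < d -> `|z s - z t| < e.
Proof.
move=> acz e e0; have [d d0 H] := acz _ e0; exists d => //.
have main s t : a <= s <= b -> a <= t <= b -> s <= t -> `|s - t| < d -> `|z s - z t| < e.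
  move=> /andP[as_ sb] /andP[at_ tb] st std.
  have := H 1%N (fun=> (s, t)); rewrite !big_ord1/= distrC; apply => //.
  - by move=> i j _ _ _; rewrite !ord1.
  - by rewrite -[t - s]ger0_norm ?subr_ge0// distrC.
move=> s t sab tab std; have [st|ts] := leP s t; first exact: main.
by rewrite distrC; apply: main => //; [exact: ltW|rewrite distrC].
Qed.

Lemma abs_continuous_bounded T z : 0 <= T -> absolutely_continuous_on 0 T z ->
  exists B : R, forall t, 0 <= t <= T -> `|z t| <= B.
Proof.
move=> T0 /abs_continuous_uniform/(_ _ ltr01)[d d0 H].
have d2 : 0 < d / 2 by rewrite divr_gt0.
have main k : forall t, 0 <= t <= T -> t <= k%:R * (d / 2) -> `|z t| <= `|z 0| + k%:R.
  elim: k => [t /andP[t0 _]|k IH t /andP[t0 tT] tk].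
    rewrite mul0r => tle0; have -> : t = 0 by apply/eqP; rewrite eq_le t0 tle0.
    by rewrite addr0.
  pose t' := Num.max 0 (t - d / 2).
  have t'0 : 0 <= t' by rewrite le_max lexx.
  have t't : t' <= t by rewrite ge_max t0 gerDl oppr_le0 ltW.
  have t't2 : t - t' <= d / 2 by rewrite lerBlDl -lerBlDr le_max lexx orbT.
  have t'k : t' <= k%:R * (d / 2).
    rewrite ge_max mulr_ge0 ?(ltW d2)//= lerBlDr.
    by rewrite (le_trans tk)// -natr1 mulrDl mul1r.
  have := IH t' _ t'k; rewrite t'0 (le_trans t't tT) => /(_ isT) H1.
  have := H t t'; rewrite t0 tT t'0 (le_trans t't tT) => /(_ isT isT) H2.
  have {}H2 : `|z t - z t'| < 1.
    apply: H2; rewrite ger0_norm ?subr_ge0// (le_lt_trans t't2)//.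
    by rewrite ltr_pdivrMr// mulr2n mulrDr mulr1 ltrDl.
  rewrite -natr1 addrA -[z t](subrK (z t')) (le_trans (ler_normD _ _))// addrC lerD// ltW//.
exists (`|z 0| + (Num.truncn (T / (d / 2))).+1%:R) => t /[dup] /andP[t0 tT] t0T.
apply: main => //; rewrite -ler_pdivrMr//.
rewrite (le_trans (ler_wpM2r _ tT)) ?invr_ge0 ?(ltW d2)//.
by apply: ltW; apply: truncnS_gt.
Qed.

Lemma abs_continuous_sqdist T z w : 0 <= T ->
  absolutely_continuous_on 0 T z -> absolutely_continuous_on 0 T w ->
  abs_continuous 0 T (fun t => dot (z t - w t) (z t - w t)).
Proof.
move=> T0 acz acw.
have [B1 HB1] := abs_continuous_bounded T0 acz.
have [B2 HB2] := abs_continuous_bounded T0 acw.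
pose L := p%:R * (2 * (B1 + B2)) + 1.
have BB : 0 <= B1 + B2.
  have := HB1 0; have := HB2 0; rewrite lexx T0 => /(_ isT) h2 /(_ isT) h1.
  by apply: addr_ge0; [exact: le_trans (normr_ge0 _) h1|exact: le_trans (normr_ge0 _) h2].
have L0 : 0 < L by rewrite /L ltr_wpDl// !mulr_ge0.
move=> e e0; have e1 : 0 < e / 2 / L by rewrite !divr_gt0.
have [d1 d10 H1] := acz _ e1; have [d2 d20 H2] := acw _ e1.
exists (Num.min d1 d2); first by rewrite lt_min d10.
move=> k I Ib tI; rewrite lt_min => /andP[/(H1 k I Ib tI) h1 /(H2 k I Ib tI) h2].
have step i : `|dot (z (I i).2 - w (I i).2) (z (I i).2 - w (I i).2) -
   dot (z (I i).1 - w (I i).1) (z (I i).1 - w (I i).1)| <=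
   L * (`|z (I i).2 - z (I i).1| + `|w (I i).2 - w (I i).1|).
  have [I1 I12 I2] := Ib i; move: (I i).1 (I i).2 I1 I12 I2 => s t s0 st tT.
  have -> : dot (z t - w t) (z t - w t) - dot (z s - w s) (z s - w s) =
    dot ((z t - z s) - (w t - w s)) ((z t - w t) + (z s - w s)).
    rewrite !dot_lin (dotC (w t) (z t)) (dotC (w s) (z s)) (dotC (w t) (z s)).
    by rewrite (dotC (z t) (w s)) (dotC (w t) (w s)) (dotC (z t) (z s)); ring.
  rewrite (le_trans (norm_dot_le _ _))// mulrCA mulrC.
  apply: ler_pM => //.
    rewrite /L ler_wpDr// ler_wpM2l// (le_trans (ler_normD _ _))//.
    have sT : 0 <= s <= T by rewrite s0 (le_trans st).
    have tT' : 0 <= t <= T by rewrite tT (le_trans s0).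
    have := ler_normB (z t) (w t); have := ler_normB (z s) (w s).
    have := HB1 _ sT; have := HB2 _ sT; have := HB1 _ tT'; have := HB2 _ tT'; lra.
  exact: ler_normB.
apply: (le_lt_trans (ler_sum _ (fun i _ => step i))).
rewrite -mulr_sumr big_split/= -ltr_pdivlMl// mulrC.
by have := ltrD h1 h2; rewrite -mulrDl -splitr.
Qed.

Lemma sqdist_nonincreasing T z w : 0 <= T ->
  absolutely_continuous_on 0 T z -> absolutely_continuous_on 0 T w ->
  {ae mu, forall t : R, 0 < t < T -> exists v1 v2,
    [/\ is_derive t 1 z v1, is_derive t 1 w v2 & dot (z t - w t) (v1 - v2) <= 0]} ->
  dot (z T - w T) (z T - w T) <= dot (z 0 - w 0) (z 0 - w 0).
Proof.
move=> T0 acz acw zw.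
have := ae_derive_le T0 (abs_continuous_sqdist T0 acz acw) (c := 0).
rewrite mul0r subr_le0; apply.
apply: ae_sub zw => t H t0T; have [v1 [v2 [d1 d2 le0]]] := H t0T.
have d12 := is_deriveB d1 d2.
exists (dot (z t - w t) (v1 - v2) + dot (v1 - v2) (z t - w t)).
  by rewrite (dotC (v1 - v2)) -mulr2n mulrn_wle0.
exact: (is_derive_dot d12 d12).
Qed.

Lemma ae_exists (P : R -> Prop) (a b : R) : a < b ->
  {ae mu, forall t, P t} -> exists2 t, a < t < b & P t.
Proof.
move=> ab [A [mA A0 PA]]; apply: contrapT => nP.
have abA : `]a, b[%classic `<=` A.
  move=> t /=; rewrite in_itv/= => tab; apply: PA => /= Pt; apply: nP; by exists t.
have : (mu `]a, b[%classic <= mu A)%E.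
  by apply: le_measure; rewrite ?inE//; exact: measurable_itv.
rewrite [X in (_ <= X)%E]A0 lebesgue_measure_itv/= lte_fin ab -EFinB lee_fin.
by rewrite subr_le0 leNgt ab.
Qed.

End Energy.

(** * Nonexpansive semiflows *)

Section EuclideanTopology.
Context {R : realType} {p : nat}.
Local Notation E := 'cV[R]_p.
Implicit Types (a b c u v w : E) (C : set E).
Local Notation sqd a b := (dot (a - b) (a - b)).

Lemma nbhs_sqdist w (e : R) : 0 < e -> \forall v \near w, sqd v w < e.
Proof.
move=> e0.
have H : sqd v w @[v --> w] --> sqd w w.
  have D : v - w @[v --> w] --> w - w by exact: (cvgB cvg_id (cvg_cst w)).
  exact: (cvg_dot D D).
by move: H; rewrite subrr dot0l => /cvgr_lt; apply.
Qed.

Lemma cvg_sqdistP (f : nat -> E) (l : E) :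
  f k @[k --> \oo] --> l <->
  forall e : R, 0 < e -> exists k0, forall k, (k0 <= k)%N -> sqd (f k) l < e.
Proof.
split=> [fl e e0|H].
  have [k0 _ Hk0] := fl _ (nbhs_sqdist l e0).
  by exists k0 => k kk; exact: Hk0.
apply: cvg_dot_dist0; apply/cvgrPdist_lt => /= e e0.
have [k0 Hk0] := H e e0; exists k0 => // k /= kk.
by rewrite sub0r normrN ger0_norm ?dot_ge0// Hk0.
Qed.

Lemma closed_sqdistP C : closed C <->
  forall c, (forall e : R, 0 < e -> exists2 a, C a & sqd a c < e) -> C c.
Proof.
split=> [cC c H|H c Hc].
  apply: cC => B /nbhs_ballP[r /= r0 rB].
  have [a Ca ac] := H (r ^+ 2) (exprn_gt0 _ r0); exists a; split => //; apply: rB.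
  rewrite -ball_normE/= distrC -(ltr_pXn2r (ltn0Sn 1)) ?nnegrE ?(ltW r0)//.
  exact: le_lt_trans (sqr_norm_le_dot _) ac.
apply: H => e e0; have [a [Ca ac]] := Hc _ (nbhs_sqdist c e0).
by exists a.
Qed.

Lemma sqdist_triangle a b c : sqd a c <= 2 * (sqd a b + sqd b c).
Proof.
rewrite -subr_ge0.
have -> : 2 * (sqd a b + sqd b c) - sqd a c = dot ((a - b) - (b - c)) ((a - b) - (b - c)).
  by rewrite !(dotDr, dotNr, dotDl, dotNl) (dotC b a) (dotC c a) (dotC c b); ring.
exact: dot_ge0.
Qed.

(** The Heine-Borel theorem for row vectors, carried over by transposition, which is continuous and
    preserves the norm. *)
Lemma compact_closed_bounded C (B : R) : closed C -> (forall c, C c -> `|c| <= B) -> compact C.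
Proof.
move=> cC CB.
have trn m' n' (u : 'M[R]_(m', n')) : `|u^T| = `|u|.
  apply/eqP; rewrite eq_le; apply/andP; split.
    rewrite [leLHS]/Num.Def.normr/= mx_normrE bigmax_le// => -[i j] _; rewrite mxE.
    rewrite [leRHS]/Num.Def.normr/= mx_normrE.
    exact: (le_bigmax _ (fun ij : 'I_m' * 'I_n' => `|u ij.1 ij.2|) (j, i)).
  rewrite [leLHS]/Num.Def.normr/= mx_normrE bigmax_le// => -[i j] _.
  rewrite [leRHS]/Num.Def.normr/= mx_normrE/=.
  have -> : u i j = u^T j i by rewrite mxE.
  exact: (le_bigmax _ (fun ij : 'I_n' * 'I_m' => `|u^T ij.1 ij.2|) (j, i)).
have ctr m' n' : continuous (fun u : 'M[R]_(m', n') => u^T).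
  move=> u; apply: (@cvg_mx_coord _ _ (nbhs u) (nbhs_filter u)) => i j; rewrite mxE.
  by under eq_cvg do rewrite mxE; exact: coord_continuous.
have -> : C = (fun u : 'rV[R]_p => u^T) @` ((fun u : 'rV[R]_p => u^T) @^-1` C).
  apply/seteqP; split=> [c Cc|c [u Cu <-]//].
  by exists c^T; rewrite /= trmxK.
apply: continuous_compact; first by apply: continuous_subspaceT; exact: ctr.
apply: bounded_closed_compact; last by apply: preimage_closed => // u _; exact: ctr.
exists B; split; first exact: num_real.
by move=> x Bx u /= /CB; rewrite trn => /le_trans; apply; exact: ltW.
Qed.

Lemma norm_le_sqdot (u : E) (B : R) : dot u u <= B -> `|u| <= 1 + B.
Proof.
move=> uB; have B0 : 0 <= B := le_trans (dot_ge0 u) uB.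
rewrite -(ler_pXn2r (ltn0Sn 1)) ?nnegrE ?addr_ge0//.
by rewrite (le_trans (sqr_norm_le_dot _))// (le_trans uB)// expr2; nra.
Qed.

Lemma cluster_sequence C (u : nat -> E) (B : R) : closed C ->
  (forall k, C (u k)) -> (forall k, dot (u k) (u k) <= B) ->
  exists2 w, C w & forall (e : R) k0, 0 < e -> exists2 k, (k0 <= k)%N & sqd (u k) w < e.
Proof.
move=> cC Cu uB.
pose D := C `&` [set v | `|v| <= 1 + B].
have cD : compact D.
  apply: (@compact_closed_bounded _ (1 + B)); last by move=> c [].
  apply: closedI => //.
  exact: (preimage_closed (fun x _ => @norm_continuous _ _ x) (@closed_le _ _)).
have FD : (u @ \oo) D.
  by exists 0%N => // k _; split => //=; exact: norm_le_sqdot.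
have [w [[Cw _] Hw]] := cD (u @ \oo) _ FD.
exists w => // e k0 e0.
have Fk : (u @ \oo) [set u k | k in [set k | (k0 <= k)%N]].
  by exists k0 => // k kk /=; exists k.
by have [_ [[k kk <-] H]] := Hw _ _ Fk (nbhs_sqdist w e0); exists k.
Qed.

Lemma min_norm_point C : closed C -> C !=set0 ->
  exists2 e, C e & forall c, C c -> dot e e <= dot c c.
Proof.
move=> cC [c0 Cc0].
have cdot : continuous (fun v : E => dot v v).
  by move=> v; exact: (cvg_dot (@cvg_id _ (nbhs v)) (@cvg_id _ (nbhs v))).
pose D := C `&` [set v | dot v v <= dot c0 c0].
have cD : compact D.
  apply: (@compact_closed_bounded _ (1 + dot c0 c0)).
    2: by move=> c [_]; exact: norm_le_sqdot.
  apply: closedI => //.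
  exact: (preimage_closed (fun x _ => cdot x) (@closed_le _ _)).
have D0 : D !=set0 by exists c0; split => /=.
have [e eD emin] := compact_EVT_min D0 cD (continuous_subspaceT cdot).
move: eD; rewrite inE => -[Ce ec0].
exists e => // c Cc; have [cc0|/ltW c0c] := leP (dot c c) (dot c0 c0).
  by apply: emin; rewrite inE; split.
exact: le_trans ec0 c0c.
Qed.

End EuclideanTopology.

Section NonexpansiveSemiflow.
Context {R : realType} {p : nat}.
Local Notation E := 'cV[R]_p.
Variables (K : set E) (Phi : R -> E -> E).
Local Notation sqd a b := (dot (a - b) (a - b)).
Hypotheses (cK : segment_convex K) (clK : closed K) (K0 : K 0).
Hypothesis PhiK : forall t x, 0 <= t -> K x -> K (Phi t x).
Hypothesis Phi0 : forall x, K x -> Phi 0 x = x.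
Hypothesis PhiD : forall s t x, 0 <= s -> 0 <= t -> K x -> Phi (t + s) x = Phi t (Phi s x).
Hypothesis Phi_ne : forall t a b, 0 <= t -> K a -> K b -> sqd (Phi t a) (Phi t b) <= sqd a b.
Hypothesis Phi_0 : forall t, 0 <= t -> Phi t 0 = 0.
Implicit Types (a b c e x y z w : E) (s t r d : R).

Lemma equilibria_convex : segment_convex (equilibrium K Phi).
Proof.
move=> a b r [Ka fa] [Kb fb] r01.
have Kc := cK Ka Kb r01; split => // t t0.
apply/eqP; rewrite -subr_eq0; apply/eqP/dot_le0.
have /andP[r0 r1] := r01; have r1' : 0 <= 1 - r by rewrite subr_ge0.
have := Phi_ne t0 Kc Ka; have := Phi_ne t0 Kc Kb; rewrite fa// fb//.
move=> /(ler_wpM2l r0) Hb /(ler_wpM2l r1') Ha.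
have := dot_dist_conv r a b ((1 - r) *: a + r *: b); rewrite subrr dot0l.
rewrite dot_dist_conv; lra.
Qed.

Lemma cvg_to_equilibrium x y : K x -> equilibrium K Phi y ->
  (forall (e : R), 0 < e -> exists2 t, 0 <= t & sqd (Phi t x) y < e) ->
  Phi t x @[t --> +oo] --> y.
Proof.
move=> Kx [Ky fy] H; apply: cvg_dot_dist0; apply/cvgrPdist_lt => /= e e0.
have [t t0 Ht] := H e e0.
near=> s; have ts : t <= s by near: s; apply: nbhs_pinfty_ge; exact: num_real.
have st0 : 0 <= s - t by rewrite subr_ge0.
rewrite sub0r normrN ger0_norm ?dot_ge0// -(subrK t s) PhiD// -[X in _ - X](fy (s - t))//.
by apply: le_lt_trans Ht; apply: Phi_ne => //; exact: PhiK.
Unshelve. all: by end_near. Qed.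

Lemma orbit_cluster x : K x -> exists y, [/\ K y,
    forall e : R, 0 < e -> exists2 t, 0 <= t & sqd (Phi t x) y < e &
    forall k : nat, exists2 s, k%:R <= s & sqd (Phi s y) y < k.+1%:R^-1].
Proof.
move=> Kx.
have [|k|y Ky Hy] := @cluster_sequence _ _ K (fun k => Phi k%:R x) (dot x x) clK.
- by move=> k; apply: PhiK => //; exact: ler0n.
- by have := Phi_ne (ler0n _ k) Kx K0; rewrite Phi_0 ?ler0n// !subr0.
exists y; split => // [e e0|k].
  by have [k _ Hk] := Hy e 0%N e0; exists k%:R.
have e0 : 0 < k.+1%:R^-1 / 4 :> R by rewrite divr_gt0// invr_gt0.
(* Two visits near [y], at least [k] apart: nonexpansiveness makes the elapsed time almost fix [y].
   The 4 pays for the factor 2 in [sqdist_triangle] and its two terms. *)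
have [k1 _ H1] := Hy _ 0%N e0; have [k2 k12 H2] := Hy _ (k1 + k)%N e0.
have kk : k%:R <= k2%:R - k1%:R :> R by rewrite lerBrDl -natrD ler_nat.
have s0 : 0 <= k2%:R - k1%:R :> R by rewrite (le_trans _ kk).
exists (k2%:R - k1%:R) => //.
have H3 := Phi_ne s0 (PhiK (ler0n _ k1) Kx) Ky; rewrite -PhiD// subrK in H3.
have := sqdist_triangle (Phi (k2%:R - k1%:R) y) (Phi k2%:R x) y.
rewrite -[sqd (Phi _ y) (Phi _ x)]dotNN opprB; move: H1 H2 H3 => /=.
move: k.+1%:R^-1 (sqd _ _) (sqd _ _) (sqd _ _) (sqd _ _) => q a b c d; lra.
Qed.

(** * The convex set of recurrent points *)

Section Recurrence.
Variable sq : nat -> R.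
Hypothesis sq_ge : forall k, k%:R <= sq k.

(* Substitute for the omega-limit set: it is moreover closed and convex, and the flow acts on
   it by affine isometries. *)
Definition recurrent : set E := [set c | K c /\ Phi (sq k) c @[k --> \oo] --> c].

Let sq_ge0 k : 0 <= sq k.
Proof. exact: le_trans (sq_ge k). Qed.

Lemma recurrent0 : recurrent 0.
Proof.
split=> //; apply/cvg_sqdistP => e e0; exists 0%N => k _.
by rewrite Phi_0// subrr dot0l.
Qed.

(** A distance lost by time [t] could never be regained, yet along [sq] it returns to its initial
    value. *)
Lemma recurrent_isometry t a b : 0 <= t -> recurrent a -> recurrent b ->
  sqd (Phi t a) (Phi t b) = sqd a b.
Proof.
move=> t0 [Ka ra] [Kb rb]; apply/eqP; rewrite eq_le Phi_ne//=.
have ab : Phi (sq k) a - Phi (sq k) b @[k --> \oo] --> a - b by exact: cvgB ra rb.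
apply: (cvgr_to_le (cvg_dot ab ab)); near=> k.
have tk : 0 <= sq k - t.
  rewrite subr_ge0 (le_trans _ (sq_ge k))//; near: k; exact: nbhs_infty_ger.
rewrite -(subrK t (sq k)) (PhiD t0 tk Ka) (PhiD t0 tk Kb); apply: Phi_ne => //; exact: PhiK.
Unshelve. all: by end_near. Qed.

Lemma recurrent_affine t a b r : 0 <= t -> recurrent a -> recurrent b -> 0 <= r <= 1 ->
  Phi t ((1 - r) *: a + r *: b) = (1 - r) *: Phi t a + r *: Phi t b.
Proof.
move=> t0 Ia Ib r01; have [Ka _] := Ia; have [Kb _] := Ib.
have Kc := cK Ka Kb r01.
apply/eqP; rewrite -subr_eq0; apply/eqP/dot_le0.
rewrite dot_dist_conv (recurrent_isometry t0 Ia Ib).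
have /andP[r0 r1] := r01; have r1' : 0 <= 1 - r by rewrite subr_ge0.
have := Phi_ne t0 Kc Ka; have := Phi_ne t0 Kc Kb.
move=> /(ler_wpM2l r0) Hb /(ler_wpM2l r1') Ha.
have := dot_dist_conv r a b ((1 - r) *: a + r *: b); rewrite subrr dot0l; lra.
Qed.

Lemma recurrent_convex : segment_convex recurrent.
Proof.
move=> a b r Ia Ib r01; have [Ka ra] := Ia; have [Kb rb] := Ib.
split; first exact: cK.
under eq_cvg do rewrite recurrent_affine//.
by apply: cvgD; apply: cvgZl_tmp.
Qed.

Lemma recurrent_invariant t c : 0 <= t -> recurrent c -> recurrent (Phi t c).
Proof.
move=> t0 [Kc rc]; split; first exact: PhiK.
apply/cvg_sqdistP => e e0; have [k0 H] := (cvg_sqdistP _ _).1 rc e e0.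
exists k0 => k /H; apply: le_lt_trans.
rewrite -(PhiD t0 (sq_ge0 k) Kc) [sq k + t]addrC (PhiD (sq_ge0 k) t0 Kc).
by apply: Phi_ne => //; exact: PhiK.
Qed.

Lemma recurrent_closed : closed recurrent.
Proof.
apply/closed_sqdistP => c Hc.
have Kc : K c.
  apply: (closed_sqdistP K).1 => // e e0.
  by have [a [Ka _] ac] := Hc e e0; exists a.
split=> //; apply/cvg_sqdistP => e e0.
have e12 : 0 < e / 12 by rewrite divr_gt0.
have [a [Ka ra] ac] := Hc _ e12.
have [k0 H] := (cvg_sqdistP _ _).1 ra _ e12.
exists k0 => k /H ak.
have := sqdist_triangle (Phi (sq k) c) (Phi (sq k) a) c.
have := sqdist_triangle (Phi (sq k) a) a c.
have := Phi_ne (sq_ge0 k) Kc Ka; rewrite -[sqd c a]dotNN opprB.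
move: ak ac; move: (sqd (Phi (sq k) c) c) (sqd _ _) (sqd _ _) (sqd _ _) (sqd _ _) => *; lra.
Qed.

(** A preimage is a cluster point of [Phi (sq k - t) y]; the shift by [N0] makes these times
    nonnegative. *)
Lemma recurrent_onto t y : 0 <= t -> recurrent y -> exists2 w, recurrent w & Phi t w = y.
Proof.
move=> t0 Iy; have [Ky ry] := Iy.
have [N0 Nt] : exists N0 : nat, t <= N0%:R.
  by exists (Num.truncn t).+1; exact/ltW/truncnS_gt.
have tk k : 0 <= sq (N0 + k) - t.
  rewrite subr_ge0 (le_trans Nt)// (le_trans _ (sq_ge _))// ler_nat leq_addr //.
have [|k|w Iw Hw] := @cluster_sequence _ _ recurrent
    (fun k => Phi (sq (N0 + k) - t) y) (dot y y) recurrent_closed.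
- by move=> k; exact: recurrent_invariant.
- have := Phi_ne (tk k) Ky K0; rewrite Phi_0; last exact: tk.
  by rewrite !subr0.
exists w => //; apply/eqP; rewrite -subr_eq0; apply/eqP/dot_le0.
apply/ler_addgt0Pr => e e0; rewrite add0r.
have e4 : 0 < e / 4 by rewrite divr_gt0.
have [k0 H] := (cvg_sqdistP _ _).1 ry _ e4.
have [k kk /= Hk] := Hw _ k0 e4.
have := H (N0 + k)%N (leq_trans kk (leq_addl _ _)).
have := Phi_ne t0 (PhiK (tk k) Ky) Iw.1; rewrite -(PhiD (tk k) t0 Ky) [t + _]addrC subrK => H1.
have := sqdist_triangle (Phi t w) (Phi (sq (N0 + k)) y) y.
rewrite -[sqd (Phi t w) (Phi (sq _) y)]dotNN opprB.
move: H1 Hk; move: (sqd (Phi t w) y) (sqd _ _) (sqd _ _) (sqd _ _) => *; lra.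
Qed.

Lemma recurrent_complete y : recurrent y -> exists z : R -> E,
  [/\ z 0 = y, forall t, recurrent (z t) & forall s t, 0 <= s -> z (t + s) = Phi s (z t)].
Proof.
move=> Iy.
have /choice[pre preP] : forall t, exists w, 0 <= t -> recurrent w /\ Phi t w = y.
  move=> t; have [t0|t0] := leP 0 t; last by exists 0.
  by have [w Iw wy] := recurrent_onto t0 Iy; exists w.
exists (fun t => if 0 <= t then Phi t y else pre (- t)); split.
- by rewrite lexx Phi0//; exact: Iy.1.
- move=> t; case: ifPn => [t0|]; first exact: recurrent_invariant.
  by rewrite -ltNge => t0; apply: (preP _ _).1; rewrite oppr_ge0 ltW.
move=> s t s0; have [t0|t0] := leP 0 t.
  by rewrite addr_ge0// addrC (PhiD t0 s0 Iy.1).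
have t0' : 0 <= - t by rewrite oppr_ge0 ltW.
have [Iw wy] := preP (- t) t0'; have Kw := Iw.1.
have [ts|ts] := leP 0 (t + s).
  rewrite -[in LHS]wy -(PhiD t0' ts Kw); by congr (Phi _ _); ring.
have ts' : 0 <= - (t + s) by rewrite oppr_ge0 ltW.
have [Iw' wy'] := preP _ ts'.
(* The chosen preimages are consistent because an isometry is injective: both points reach [y] after
   time [- (t + s)]. *)
apply/eqP; rewrite -subr_eq0; apply/eqP/dot_le0.
rewrite -(recurrent_isometry ts' Iw' (recurrent_invariant s0 Iw)) wy' -(PhiD s0 ts' Kw).
have -> : - (t + s) + s = - t by ring.
by rewrite wy subrr dot0l.
Qed.

(* A fixed point [e] of the isometry group such that the whole orbit [z] lies in the minimal
   face of [e]: the set of points of [recurrent] which dominate the orbit with a fixed margin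
   is convex, closed and invariant, and its element of least norm cannot move. *)
Lemma recurrent_barycenter (z : R -> E) :
  (forall t, recurrent (z t)) -> (forall s t, 0 <= s -> z (t + s) = Phi s (z t)) ->
  exists e, equilibrium K Phi e /\
    exists2 d : R, 0 < d & forall t, K (e + d *: (e - z t)).
Proof.
move=> Iz zD.
(* The orbit lies on a sphere about the fixed point 0, so one margin [d] from [relint_point] serves
   all its points. *)
have norm_z t : dot (z t) (z t) = dot (z 0) (z 0).
  have N (s : R) u : 0 <= s -> dot (z (u + s)) (z (u + s)) = dot (z u) (z u).
    move=> s0; have := recurrent_isometry s0 (Iz u) recurrent0.
    by rewrite Phi_0// !subr0 -zD.
  have [t0|t0] := leP 0 t; first by have := N t 0 t0; rewrite add0r.
  by have := N (- t) t; rewrite subrr => -> //; rewrite oppr_ge0 ltW.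
have [c Ic Hc] := relint_point recurrent_convex recurrent0.
have [d d0 Hd] := Hc (dot (z 0) (z 0)).
pose D := recurrent `&` [set e | forall t, recurrent (e + d *: (e - z t))].
have clD : closed D.
  apply/closed_sqdistP => a Ha; split.
    by apply: (closed_sqdistP _).1 recurrent_closed _ _ => e /Ha [b [Ib _] ab]; exists b.
  move=> t; apply: (closed_sqdistP _).1 recurrent_closed _ _ => e e0.
  have d1 : 0 < (1 + d) ^+ 2 by rewrite exprn_gt0// addr_gt0.
  have [|b [_ Hb] ab] := Ha (e / (1 + d) ^+ 2); first by rewrite divr_gt0.
  exists (b + d *: (b - z t)) => //.
  have -> : b + d *: (b - z t) - (a + d *: (a - z t)) = (1 + d) *: (b - a).
    by apply/colP => i; rewrite !mxE; ring.
  by rewrite dotZl dotZr mulrA -expr2 mulrC -ltr_pdivlMr.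
have cD : segment_convex D.
  move=> a b r [Ia Ha] [Ib Hb] r01; split; first exact: recurrent_convex.
  move=> t /=; have := recurrent_convex (Ha t) (Hb t) r01; congr recurrent.
  by apply/colP => i; rewrite !mxE; ring.
have D0 : D !=set0.
  by exists c; split => // t /=; apply: Hd => //; rewrite norm_z.
have [e De emin] := min_norm_point clD D0.
exists e; have [Ie He] := De; split; last by exists d => // t; exact: (He t).1.
split; [exact: Ie.1|move=> s s0].
have d1 : 0 < 1 + d by rewrite addr_gt0.
have De' : D (Phi s e).
  split; first exact: recurrent_invariant.
  move=> t /=; have zt : z t = Phi s (z (t - s)) by rewrite -zD// subrK.
  have := recurrent_invariant s0 (He (t - s)); congr recurrent.
  (* The weight that writes [e] as a combination of its extension and [z (t - s)]; affinity of the
     flow then shows that the extension of [e] moves to the extension of [Phi s e] with the same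
     margin. *)
  have r01 : 0 <= d / (1 + d) <= 1.
    by rewrite divr_ge0 ?(ltW d0) ?(ltW d1)//= ler_pdivrMr// mul1r lerDr.
  have := recurrent_affine s0 (He (t - s)) (Iz (t - s)) r01.
  have -> : (1 - d / (1 + d)) *: (e + d *: (e - z (t - s))) + d / (1 + d) *: z (t - s) = e.
    by apply/colP => i; rewrite !mxE; field; rewrite gt_eqF.
  move=> ->; rewrite -zt; apply/colP => i; rewrite !mxE; field; rewrite gt_eqF//.
have ee : dot (Phi s e) (Phi s e) <= dot e e.
  by have := Phi_ne s0 Ie.1 K0; rewrite Phi_0// !subr0.
(* The midpoint of [e] and [Phi s e] would have smaller norm than [e] if the two were distinct. *)
have h01 : 0 <= (2^-1 : R) <= 1 by lra.
have := emin _ (cD _ _ _ De' De h01).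
have := dot_dist_conv 2^-1 (Phi s e) e 0; rewrite !sub0r !dotNN => -> H.
apply/eqP; rewrite -subr_eq0; apply/eqP/dot_le0; lra.
Qed.

End Recurrence.

End NonexpansiveSemiflow.

(** * The subgradient flow on its limit sets *)

Section EverywhereDerivative.
Context {R : realType} {p : nat}.
Local Notation E := 'cV[R]_p.
Local Notation mu := (@lebesgue_measure R).

Lemma gauge_is_derive (h : R -> R) (t l : R) :
  (forall e : R, 0 < e -> exists2 d : R, 0 < d & forall s, `|s - t| < d ->
    `|h s - h t - l * (s - t)| <= e * `|s - t|) -> is_derive t 1 h l.
Proof.
move=> H; apply/is_deriveP/cvgrPdist_le => /= e e0.
have [d d0 Hd] := H e e0; rewrite near_withinE; apply/nbhs_ballP; exists d => // s.
rewrite -ball_normE/= sub0r normrN => sd s0.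
have := Hd (s + t); rewrite addrK [_%:A]mulr1 => /(_ sd) {}Hd.
have -> : l - s^-1 *: (h (s + t) - h t) = - (s^-1 * (h (s + t) - h t - l * s)).
  by rewrite [_ *: _ in LHS](_ : _ = s^-1 * (h (s + t) - h t))//; field.
by rewrite normrN normrM normfV ler_pdivrMl ?normr_gt0// [leRHS]mulrC.
Qed.

Lemma abs_continuous_coord a b a' b' (w : R -> E) i : a' <= a -> b <= b' ->
  absolutely_continuous_on a' b' w -> abs_continuous a b (fun t => w t i 0).
Proof.
move=> aa bb acw e e0; have [d d0 H] := acw e e0; exists d => // k I Ib tI Id.
have Ib' j : [/\ a' <= (I j).1, (I j).1 <= (I j).2 & (I j).2 <= b'].
  by have [? ? ?] := Ib j; split => //; [exact: le_trans aa _|exact: le_trans bb].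
apply: le_lt_trans (H k I Ib' tI Id); apply: ler_sum => j _.
by have := coord_le_norm (w (I j).2 - w (I j).1) i; rewrite !mxE.
Qed.

Lemma abs_continuousN a b (h : R -> R) :
  abs_continuous a b h -> abs_continuous a b (fun t => - h t).
Proof.
move=> H e /H[d d0 {}H]; exists d => // k I Ib tI Id.
by under eq_bigr do rewrite -opprD normrN; exact: H.
Qed.

(** Near [t] the coordinates of [g] are within [e] of their values at [t]; [ae_derive_le], applied
    to each coordinate and to its negative, bounds the difference quotients from both sides. *)
Lemma ae_derive_everywhere (w g : R -> E) (T t : R) :
  absolutely_continuous_on 0 T w ->
  {ae mu, forall s : R, 0 < s < T -> is_derive s 1 w (g s)} ->
  0 < t < T -> {for t, continuous g} -> is_derive t 1 w (g t).
Proof.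
move=> acw wg /andP[t0 tT] gt; apply: is_derive_mx => i j; rewrite ord1.
apply: gauge_is_derive => e e0.
have /cvgrPdist_le/(_ _ e0)/nbhs_ballP[d /= d0 Hd] : g s i 0 @[s --> t] --> g t i 0.
  exact: cvg_coord gt.
pose q := Num.min d (Num.min t (T - t)).
have q0 : 0 < q by rewrite !lt_min d0 t0 subr_gt0.
have slope a b : a <= b -> `|a - t| < q -> `|b - t| < q ->
    `|w b i 0 - w a i 0 - g t i 0 * (b - a)| <= e * (b - a).
  move=> ab aq bq.
  have a0 : 0 <= a.
    by move: aq; rewrite /q !lt_min => /and3P[_]; rewrite ltr_norml => /andP[+ _] _; lra.
  have bT : b <= T.
    by move: bq; rewrite /q !lt_min => /and3P[_ _]; rewrite ltr_norml => /andP[_]; lra.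
  have near_g s : a < s < b -> `|g t i 0 - g s i 0| <= e.
    move=> /andP[as_ sb]; apply: Hd; rewrite -ball_normE/= distrC.
    have : `|s - t| < q.
      move: aq bq; rewrite !ltr_norml => /andP[aq _] /andP[_ bq].
      by apply/andP; split; lra.
    by move=> /lt_le_trans; apply; rewrite ge_min lexx.
  have dg : {ae mu, forall s : R, a < s < b -> is_derive s 1 (fun t => w t i 0) (g s i 0)}.
    apply: ae_sub wg => s H /andP[as_ sb]; apply: is_derive_coord; apply: H.
    by rewrite (le_lt_trans a0)//= (lt_le_trans sb).
  have H1 : w b i 0 - w a i 0 <= (g t i 0 + e) * (b - a).
    apply: (ae_derive_le (h := fun s => w s i 0) ab (abs_continuous_coord i a0 bT acw)).
    apply: ae_sub dg => s H sab; exists (g s i 0); last exact: H.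
    by have := near_g s sab; rewrite ler_norml => /andP[]; lra.
  have H2 : - w b i 0 - - w a i 0 <= (- g t i 0 + e) * (b - a).
    apply: (ae_derive_le (h := fun s => - w s i 0) ab).
      exact/abs_continuousN/(abs_continuous_coord i a0 bT acw).
    apply: ae_sub dg => s H sab; exists (- g s i 0); last exact: is_deriveN (H sab).
    by have := near_g s sab; rewrite ler_norml => /andP[]; lra.
  by rewrite ler_norml; apply/andP; split; lra.
exists q => // s sq; have tq : `|t - t| < q by rewrite subrr normr0.
have [ts|st] := leP t s; first by rewrite (@ger0_norm _ (s - t)) ?subr_ge0//; exact: slope.
rewrite [in leRHS]distrC (@ger0_norm _ (t - s)) ?subr_ge0 ?(ltW st)//.
have := slope s t (ltW st) sq tq; rewrite -normrN; congr (`|_| <= _); ring.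
Qed.

End EverywhereDerivative.

Section SemidefiniteKernel.
Context {R : realType} {p : nat}.

(** A zero of a nonpositive form is a maximum, so the first-order term along [B *m c], which is
    twice its squared norm, must vanish. *)
Lemma semidefinite_kernel (B : 'M[R]_p) (c : 'cV[R]_p) : B^T = B ->
  (forall v, dot (B *m v) v <= 0) -> dot (B *m c) c = 0 -> B *m c = 0.
Proof.
move=> Bs Bn Bc; apply: dot_le0; set u := B *m c.
set al := dot u u; pose be := dot (B *m u) u.
have al0 : 0 <= al := dot_ge0 u.
have be0 : be <= 0 := Bn u.
have H (t : R) : 2 * t * al + t ^+ 2 * be <= 0.
  have := Bn (c + t *: u).
  rewrite mulmxDr -scalemxAr !dotDl !dotDr !dotZl !dotZr Bc -/u -/al -/be.
  have -> : dot (B *m u) c = al by rewrite dot_mulmx Bs.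
  by rewrite -/u; lra.
have b1 : 0 < 1 - be by rewrite subr_gt0 (le_lt_trans be0).
(* The step [al / (1 - be)] makes the linear term win over the quadratic one; [1 - be] stays
   positive even when [be] is 0. *)
have := H (al / (1 - be)).
have -> : 2 * (al / (1 - be)) * al + (al / (1 - be)) ^+ 2 * be =
  al ^+ 2 * (2 - be) / (1 - be) ^+ 2 by field; rewrite gt_eqF.
rewrite ler_pdivrMr ?exprn_gt0// mul0r pmulr_lle0; last by rewrite subr_gt0 (le_lt_trans be0).
move=> al2; have /eqP := le_anti (introT andP (conj al2 (sqr_ge0 al))).
by rewrite sqrf_eq0 => /eqP ->.
Qed.

End SemidefiniteKernel.

Section SubgradientFlow.
Context {R : realType} {n m : nat}.
Local Notation E := 'cV[R]_(n + m).
Variables (Kx : set 'cV[R]_n) (Ky : set 'cV[R]_m) (phi : 'cV[R]_n -> 'cV[R]_m -> R).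
Let K := product_set Kx Ky.
Variable Phi : R -> E -> E.
Local Notation f := (saddle_field phi).
Local Notation sqd a b := (dot (a - b) (a - b)).
Local Notation mu := (@lebesgue_measure R).
Hypotheses (clKx : closed Kx) (clKy : closed Ky) (cKx : convex_set Kx) (cKy : convex_set Ky).
Hypotheses (phi2 : C2_near K (joint phi)) (phicc : concave_convex_on Kx Ky phi).
Hypothesis flow : is_subgradient_method K phi Phi.
Implicit Types (a b c e z w v : E).

Definition normal_part z := euclidean_proj (normal_cone K z) (f z).

(** The default value 0 of [euclidean_proj] also lies in the cone. *)
Lemma normal_partP z : normal_cone K z (normal_part z).
Proof.
rewrite /normal_part /euclidean_proj; case: xgetP => [q _ []//|_].
by move=> w _; rewrite dot0l.
Qed.

Lemma closed_product : closed K.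
Proof.
have cl (q : nat) (C : set 'cV[R]_q) (g : E -> 'cV[R]_q) (k : 'I_q -> 'I_(n + m)) :
    (forall z i, g z i 0 = z (k i) 0) -> closed C -> closed [set z | C (g z)].
  move=> gE cC; apply: (preimage_closed _ cC) => z _.
  apply: (@cvg_mx_coord _ _ (nbhs z) (nbhs_filter z)) => i j; rewrite ord1 gE.
  by under eq_cvg do rewrite gE; exact: coord_continuous.
apply: closedI.
  by apply: (cl _ _ _ (lshift m)) => // z i; rewrite mxE.
by apply: (cl _ _ _ (@rshift n m)) => // z i; rewrite mxE.
Qed.

Lemma flowK t z : 0 <= t -> K z -> K (Phi t z).
Proof. by case: flow => -[H _ _ _] _; exact: H. Qed.

Lemma flow0 z : K z -> Phi 0 z = z.
Proof. by case: flow => -[_ H _ _] _; exact: H. Qed.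

Lemma flowD s t z : 0 <= s -> 0 <= t -> K z -> Phi (t + s) z = Phi t (Phi s z).
Proof. by case: flow => -[_ _ H _] _; exact: H. Qed.

Lemma flow_ac T z : 0 <= T -> K z -> absolutely_continuous_on 0 T (Phi ^~ z).
Proof. by case: flow => _ H T0 /H[_ + _]; exact. Qed.

Lemma flow_derive z : K z -> {ae mu, forall t : R, 0 <= t ->
  is_derive t 1 (Phi ^~ z) (f (Phi t z) - normal_part (Phi t z))}.
Proof. by case: flow => _ H /H[_ _]. Qed.

Lemma normal_mono z w u v : K z -> K w -> normal_cone K z u -> normal_cone K w v ->
  dot (z - w) ((f z - u) - (f w - v)) <= 0.
Proof.
move=> Kz Kw /(_ _ Kw) zu /(_ _ Kz) wv.
have := saddle_field_mono phi2 phicc Kz Kw; rewrite dotC.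
move: zu wv; move: (f z) (f w) => a b; rewrite (dotC u) (dotC v).
by rewrite !(dotDr, dotNr, dotDl, dotNl); lra.
Qed.

Lemma flow_nonexpansive t a b : 0 <= t -> K a -> K b -> sqd (Phi t a) (Phi t b) <= sqd a b.
Proof.
move=> t0 Ka Kb.
have := sqdist_nonincreasing t0 (flow_ac t0 Ka) (flow_ac t0 Kb).
rewrite !flow0//; apply.
apply: ae_sub (ae_and (flow_derive Ka) (flow_derive Kb)) => s [da db] /andP[s0 _].
have s0' := ltW s0.
exists (f (Phi s a) - normal_part (Phi s a)), (f (Phi s b) - normal_part (Phi s b)).
split; [exact: da|exact: db|].
by apply: normal_mono; [exact: flowK|exact: flowK|exact: normal_partP|exact: normal_partP].
Qed.

Lemma equilibrium_saddle e : equilibrium K Phi e <-> restricted_saddle K phi e.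
Proof.
have saddleP := restricted_saddleP cKx cKy phi2 phicc e.
split=> [[Ke fe]|/saddleP[Ke ne]].
  apply/saddleP; split => //.
  have [t /andP[t0 _] Ht] := ae_exists (ltr01 (R := R)) (flow_derive Ke).
  have {}Ht := Ht (ltW t0); rewrite fe ?(ltW t0)// in Ht.
  have He : is_derive t 1 (Phi ^~ e) 0.
    apply: near_eq_is_derive (is_derive_cst e t 1).
    near=> s; rewrite fe//; apply: ltW; near: s; exact: lt_nbhsr.
  have : f e - normal_part e = 0 by rewrite -(@derive_val _ _ _ _ _ _ _ Ht) derive_val.
  by move=> /eqP; rewrite subr_eq0 => /eqP ->; exact: normal_partP.
split => // t t0.
apply/eqP; rewrite -subr_eq0; apply/eqP/dot_le0.
have ace : absolutely_continuous_on 0 t (fun _ => e).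
  move=> q q0; exists 1 => // k I _ _ _.
  by rewrite big1// => i _; rewrite subrr normr0.
have := sqdist_nonincreasing t0 (flow_ac t0 Ke) ace.
rewrite flow0// subrr dot0l; apply.
apply: ae_sub (flow_derive Ke) => s ds /andP[s0 _].
(* The zero velocity of the constant curve is written so that [f e] serves as the normal vector at
   [e] in [normal_mono]. *)
exists (f (Phi s e) - normal_part (Phi s e)), (f e - f e).
split; [by apply: ds; exact: ltW|rewrite subrr; exact: (is_derive_cst e)|].
by apply: normal_mono => //; [exact: flowK (ltW s0) Ke|exact: normal_partP].
Unshelve. all: by end_near. Qed.

(** * The vector field on recurrent points *)

Section LimitSet.
Let S := restricted_saddle K phi.
Let F := minimal_face K S.
Let V := affine_span F.
Variable Pi : 'M[R]_(n + m).
Hypothesis saddle0 : S 0.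
Hypothesis PiE : forall v, Pi *m v = euclidean_proj (orth_complement (affine_normal_cone V)) v.
Variable sq : nat -> R.
Hypothesis sq_ge : forall k, k%:R <= sq k.
Local Notation rec := (recurrent K Phi sq).

Let K0 : K 0. Proof. by case: saddle0. Qed.

Let convK : segment_convex K. Proof. exact: segment_convex_product. Qed.

Let clK : closed K := closed_product.

Let flow_0 t : 0 <= t -> Phi t 0 = 0.
Proof. by move=> t0; have [_ ->] := (equilibrium_saddle 0).2 saddle0. Qed.

Let convS : segment_convex S.
Proof.
move=> a b r /equilibrium_saddle Sa /equilibrium_saddle Sb r01; apply/equilibrium_saddle.
exact: (equilibria_convex convK flow_nonexpansive Sa Sb r01).
Qed.

Let F0 : F 0. Proof. exact: sub_minimal_face. Qed.

Let aV : is_affine V := @is_affine_span _ _ F.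

Let V0 : V 0. Proof. exact: sub_affine_span. Qed.

(** A relative interior point of the convex set of saddles: every saddle extends through it, so its
    face contains all of them and hence the minimal one. *)
Lemma saddle_relint : exists e, [/\ S e, F `<=` opposite_extends K e & V `<=` two_sided K e].
Proof.
have [e Se He] := relint_point convS saddle0.
have Ke : K e by case: Se.
have FG : F `<=` opposite_extends K e.
  apply: minimal_face_sub_opposite => // s Ss; split; first by case: Ss.
  by have [d d0 Hd] := He (dot s s); exists d => //; case: (Hd s Ss (lexx _)).
by exists e; split => //; exact: affine_span_two_sided.
Qed.

Lemma recurrent_face c : rec c -> F c.
Proof.
move=> Ic.
have [z [z0 Iz zD]] := recurrent_complete clK K0 flowK flow0 flowD flow_nonexpansive flow_0
  sq_ge Ic.
have [e [/equilibrium_saddle Se [d d0 Hd]]] := recurrent_barycenter convK clK K0 flowK flowD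
  flow_nonexpansive flow_0 sq_ge Iz zD.
rewrite -z0; apply: (minimal_face_extend convK Se _ d0 (Hd 0)); exact: (Iz 0).1.
Qed.

Lemma recurrent_span c : rec c -> V c.
Proof. by move=> /recurrent_face; exact: sub_affine_span. Qed.

Lemma saddle_recurrent e : S e -> rec e.
Proof.
move=> /equilibrium_saddle[Ke fe]; split => //.
under eq_cvg do rewrite fe ?(le_trans _ (sq_ge _))//.
exact: cvg_cst.
Qed.

Lemma saddle_normal e : S e -> normal_cone K e (f e).
Proof. by move=> /(restricted_saddleP cKx cKy phi2 phicc)[]. Qed.

(* Along a limit trajectory the distance to each saddle point is constant, so the three
   nonpositive contributions to its derivative vanish. *)
Lemma normal_part_orth_saddle e c w (nw : E) t : 0 < t -> S e -> rec c -> w = Phi t c ->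
  normal_cone K w nw -> is_derive t 1 (Phi ^~ c) (f w - nw) -> dot nw (e - w) = 0.
Proof.
move=> t0 Se Ic wE nwK dw; have [Ke fe] := (equilibrium_saddle e).2 Se; have [Kc _] := Ic.
have Kw : K w by rewrite wE; exact: flowK (ltW t0) Kc.
have dist (s : R) : 0 <= s -> sqd (Phi s c) e = sqd c e.
  move=> s0.
  have := recurrent_isometry flowK flowD flow_nonexpansive sq_ge s0 Ic (saddle_recurrent Se).
  by rewrite (fe s s0).
have d0 : is_derive t 1 (fun s => sqd (Phi s c) e) 0.
  apply: near_eq_is_derive (is_derive_cst (sqd c e) t 1).
  by near=> s; rewrite dist//; apply: ltW; near: s; exact: lt_nbhsr.
have dwe : is_derive t 1 (fun s => Phi s c - e) (f w - nw).
  by have := is_deriveB dw (is_derive_cst e t 1); rewrite subr0.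
have dd := is_derive_dot dwe dwe.
have : dot (w - e) (f w - nw) = 0.
  have := @derive_val _ _ _ _ _ _ _ d0; rewrite (@derive_val _ _ _ _ _ _ _ dd).
  rewrite /= -wE (dotC (f w - nw)) => H; lra.
have := saddle_field_mono phi2 phicc Kw Ke; have := nwK _ Ke; have := saddle_normal Se Kw.
move: (f w) (f e) => a b; rewrite !(dotDr, dotNr, dotDl, dotNl).
rewrite (dotC w a) (dotC w nw) (dotC e a) (dotC e nw); lra.
Unshelve. all: by end_near. Qed.

Lemma recurrent_ae_derive c : rec c ->
  {ae mu, forall t : R, 0 < t -> is_derive t 1 (Phi ^~ c) (Pi *m f (Phi t c))}.
Proof.
move=> Ic; have [Kc _] := Ic.
have [e [Se FG _]] := saddle_relint.
apply: ae_sub (flow_derive Kc) => t H t0; have {}H := H (ltW t0).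
set w := Phi t c in H *; set nw := normal_part w in H.
have nwK : normal_cone K w nw := normal_partP w.
have Kw : K w := flowK (ltW t0) Kc.
have ne := normal_part_orth_saddle t0 Se Ic erefl nwK H.
have n0 := normal_part_orth_saddle t0 saddle0 Ic erefl nwK H.
have nw0 : dot nw w = 0 by move: n0; rewrite sub0r dotNr => /eqP; rewrite oppr_eq0 => /eqP.
have ne0 : dot nw e = 0 by move: ne; rewrite dotDr dotNr nw0 subr0.
have nV : affine_normal_cone V nw.
  apply/(affine_normal_coneP V0) => v.
  exact: (normal_orth_affine_span Kw nwK ne ne0 FG).
(* The curve stays in [V], so its product with any normal vector vanishes identically and so does
   the derivative of that product. *)
have wV : V (f w - nw).
  rewrite -(orth_complement_normal aV V0) => u uN; rewrite dotC.
  have d0 : is_derive t 1 (fun s => dot u (Phi s c)) 0.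
    apply: near_eq_is_derive (is_derive_cst 0 t 1).
    near=> s; have s0 : 0 <= s by apply: ltW; near: s; exact: lt_nbhsr.
    move/(affine_normal_coneP V0) : uN => ->//; apply: recurrent_span.
    exact: (recurrent_invariant flowK flowD flow_nonexpansive sq_ge s0 Ic).
  have dd := is_derive_dot (is_derive_cst u t 1) H.
  have := @derive_val _ _ _ _ _ _ _ d0; rewrite (@derive_val _ _ _ _ _ _ _ dd).
  by rewrite dot0l addr0.
have -> : Pi *m f w = f w - nw.
  rewrite -(proj_id aV V0 PiE wV) mulmxDr mulmxN (proj_normal aV V0 PiE nV) subr0 //.
exact: H.
Unshelve. all: by end_near. Qed.

(** Restarting at [t - 1] makes any real [t], negative included, the interior time 1 of the interval
    from 0 to 2, where the field is continuous along the curve. *)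
Lemma recurrent_derive (z : R -> E) (t : R) :
  (forall t, rec (z t)) -> (forall s t, 0 <= s -> z (t + s) = Phi s (z t)) ->
  is_derive t 1 z (Pi *m f (z t)).
Proof.
move=> Iz zD; set c := z (t - 1); have [Kc _] := Iz (t - 1).
have zE (s : R) : 0 <= s -> z (s + (t - 1)) = Phi s c by move=> s0; rewrite addrC zD.
have ac2 := flow_ac (ler0n R 2) Kc.
have cw : Phi s c @[s --> (1 : R)] --> Phi 1 c.
  apply/cvgrPdist_lt => /= e e0.
  have [d d0 Hd] := abs_continuous_uniform ac2 e0.
  have near_d : \forall s \near (1 : R), `|1 - s| < d.
    by have := nbhsx_ballx (1 : R) _ d0; rewrite -ball_normE.
  near=> s; have s0 : 0 <= s by apply: ltW; near: s; exact: lt_nbhsr.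
  have s2 : s <= 2 by apply: ltW; near: s; apply: lt_nbhsl; rewrite ltr1n.
  by apply: Hd; rewrite ?s0 ?s2 ?ler01 ?ler1n//; near: s.
have [U [oU KU [g1 _]]] := phi2.
have cg : {for (1 : R), continuous (fun s => Pi *m f (Phi s c))}.
  apply: cvg_mulmx; first exact: cvg_cst.
  by apply: (cvg_saddle_field _ g1 cw); apply: KU; exact: flowK.
have D1 : is_derive (1 : R) 1 (Phi ^~ c) (Pi *m f (Phi 1 c)).
  apply: (ae_derive_everywhere ac2 _ _ cg); last by rewrite ltr01 ltr1n.
  by apply: ae_sub (recurrent_ae_derive (Iz (t - 1))) => s H /andP[s0 _]; exact: H.
have z1 : z t = Phi 1 c by rewrite -zE// addrCA subrr addr0.
rewrite z1; apply/is_deriveP; have /is_deriveP := D1.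
apply: cvg_trans; apply: near_eq_cvg; near=> h.
rewrite -z1 [_%:A]mulr1; congr (_ *: (_ - _)); rewrite ?z1// -zE.
  by congr z; ring.
have : `|h| <= 1 by near: h; apply: dnbhs0_le.
rewrite ler_norml => /andP[]; lra.
Unshelve. all: by end_near. Qed.

Lemma recurrent_scale c (r : R) : rec c -> 0 <= r <= 1 -> rec (r *: c).
Proof.
move=> Ic r01; have r0 : rec 0 := recurrent0 K0 flow_0 sq_ge.
have := recurrent_convex convK flowK flowD flow_nonexpansive sq_ge r0 Ic r01.
by rewrite scaler0 add0r.
Qed.

Lemma proj_recurrent c : rec c -> Pi *m c = c.
Proof. by move=> Ic; exact: (proj_id aV V0 PiE (recurrent_span Ic)). Qed.

(* The flow on [rec] is affine and fixes 0, so [r *: z] is a trajectory whenever [z] is. *)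
Lemma recurrent_field_scale c (r : R) : rec c -> 0 <= r <= 1 ->
  Pi *m f (r *: c) = r *: (Pi *m f c).
Proof.
move=> Ic r01.
have [z [z0 Iz zD]] := recurrent_complete clK K0 flowK flow0 flowD flow_nonexpansive flow_0
  sq_ge Ic.
have D1 := recurrent_derive 0 Iz zD.
have D2 : is_derive (0 : R) 1 (fun t => r *: z t) (Pi *m f (r *: z 0)).
  apply: recurrent_derive => [t|s t s0]; first exact: recurrent_scale.
  have r0 : rec 0 := recurrent0 K0 flow_0 sq_ge.
  have := recurrent_affine convK flowK flowD flow_nonexpansive sq_ge s0 r0 (Iz t) r01.
  by rewrite scaler0 add0r flow_0// scaler0 add0r zD.
have D3 := is_deriveZ r D1.
by rewrite -z0 -(@derive_val _ _ _ _ _ _ _ D2) -(@derive_val _ _ _ _ _ _ _ D3).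
Qed.

Lemma recurrent_norm c (t : R) : 0 <= t -> rec c -> dot (Phi t c) (Phi t c) = dot c c.
Proof.
move=> t0 Ic; have r0 : rec 0 := recurrent0 K0 flow_0 sq_ge.
have := recurrent_isometry flowK flowD flow_nonexpansive sq_ge t0 Ic r0.
by rewrite flow_0// !subr0.
Qed.

(** The norm is conserved along the complete trajectory through [c]; the factor [Pi] moves onto [c],
    which it fixes. *)
Lemma recurrent_field_orth c : rec c -> dot (f c) c = 0.
Proof.
move=> Ic.
have [z [z0 Iz zD]] := recurrent_complete clK K0 flowK flow0 flowD flow_nonexpansive flow_0
  sq_ge Ic.
have D1 := recurrent_derive 0 Iz zD; have D2 := is_derive_dot D1 D1.
have D3 : is_derive (0 : R) 1 (fun s => dot (z s) (z s)) 0.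
  apply: near_eq_is_derive (is_derive_cst (dot (z (-1)) (z (-1))) (0 : R) 1).
  near=> s; have s1 : 0 <= s + 1.
    by rewrite -lerBlDr sub0r; apply: ltW; near: s; apply: lt_nbhsr; rewrite oppr_lt0.
  by rewrite /cst -(recurrent_norm s1 (Iz (-1))) -zD//; congr (dot (z _) (z _)); ring.
have := @derive_val _ _ _ _ _ _ _ D3; rewrite (@derive_val _ _ _ _ _ _ _ D2).
rewrite z0 (dotC c) dot_mulmx (proj_sym aV V0 PiE) proj_recurrent// => H; lra.
Unshelve. all: by end_near. Qed.

(* At relative interior points of [F] every direction of [V] is feasible, so monotonicity of
   the field gives the sign; the other points of [F] are limits of these. *)
Lemma saddle_jacobian_neg q v : F q -> V v ->
  dot ((matA phi q + matB phi q) *m v) v <= 0.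
Proof.
move=> Fq Vv; have [e [[Ke _] FG VU]] := saddle_relint.
have [Kq _] := FG q Fq.
have [s0 s00 [Kp _]] := VU v Vv.
have [U [oU KU g2]] := phi2.
have main (h : R) : 0 < h <= 1 ->
    dot ((matA phi ((1 - h) *: q + h *: e) + matB phi ((1 - h) *: q + h *: e)) *m v) v <= 0.
  move=> /andP[h0 h1]; have h01 : 0 <= h <= 1 by rewrite (ltW h0).
  (* The scale of [v'] makes [qh + v'] the combination of [q] and [e + s0 *: v], a point of [K]. *)
  set qh := (1 - h) *: q + h *: e; set v' := (h * s0) *: v.
  have Kqh : K qh by exact: convK.
  have Kqv (s : R) : 0 <= s <= 1 -> K (qh + s *: v').
    move=> s01; have Kv : K (qh + v').
      by have := convK Kq Kp h01; congr K; apply/colP => i; rewrite !mxE; ring.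
    by have := convK Kqh Kv s01; congr K; apply/colP => i; rewrite !mxE; ring.
  have Uq : U (qh + 0 *: v') by rewrite scale0r addr0; exact: KU.
  have D := is_derive_dot (is_derive_saddle_field oU Uq g2) (is_derive_cst v' (0 : R) 1).
  rewrite dot0r add0r scale0r addr0 in D.
  have : dot ((matA phi qh + matB phi qh) *m v') v' <= 0.
    apply: (is_derive_le_slope D) => s /andP[s_gt0 s1].
    rewrite mul0r /= scale0r addr0 -(ler_pM2l s_gt0) mulr0.
    have Ks := Kqv s; rewrite (ltW s_gt0) s1 in Ks.
    have := saddle_field_mono phi2 phicc (Ks isT) Kqh.
    rewrite (_ : qh + s *: v' - qh = s *: v'); last by rewrite addrAC subrr add0r.
    by move: (f _) (f _) => a b; rewrite dotZr dotDl dotNl.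
  rewrite /v' -scalemxAr dotZl dotZr mulrA -expr2 pmulr_rle0//.
  by rewrite exprn_gt0// mulr_gt0.
have hc : (@harmonic R) k @[k --> \oo] --> (0 : R) by exact: cvg_harmonic.
have hc1 : (1 - harmonic k : R) @[k --> \oo] --> (1 - 0 : R).
  by apply: cvgB => //; exact: cvg_cst.
have qc : (1 - harmonic k) *: q + harmonic k *: e @[k --> \oo] --> (1 - 0) *: q + 0 *: e.
  by apply: cvgD; exact: cvgZr_tmp.
rewrite subr0 scale1r scale0r addr0 in qc.
have [cA cB] := cvg_matAB (KU _ Kq) g2 qc.
pose qk k := (1 - harmonic k) *: q + harmonic k *: e.
have cM : dot ((matA phi (qk k) + matB phi (qk k)) *m v) v @[k --> \oo] -->
    dot ((matA phi q + matB phi q) *m v) v.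
  apply: cvg_dot; last exact: cvg_cst.
  by apply: cvg_mulmx; [exact: cvgD cA cB|exact: cvg_cst].
apply: (cvgr_to_le cM); near=> k; apply: main.
by rewrite /harmonic invr_gt0 ltr0n/= invf_le1// ler1n.
Unshelve. all: by end_near. Qed.

Lemma matA_quadratic q v : K q -> dot (matA phi q *m v) v = 0.
Proof.
move=> Kq; have [U [oU KU g2]] := phi2.
have := dot_mulmx (matA phi q) v v; rewrite (matA_skew oU (KU _ Kq) g2) mulNmx dotNr dotC.
by move=> H; lra.
Qed.

(** Restricted to the open interval, because differentiating at [r] needs the scaling identities on
    both sides of [r]. *)
Lemma recurrent_kernel_interior c (r : R) : rec c -> 0 < r < 1 ->
  Pi *m matB phi (r *: c) *m Pi *m c = 0 /\ Pi *m matA phi (r *: c) *m Pi *m c = Pi *m f c.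
Proof.
move=> Ic /andP[r0 r1]; have r01 : 0 <= r <= 1 by rewrite !ltW.
have Irc := recurrent_scale Ic r01; have [Krc _] := Irc.
have [U [oU KU g2]] := phi2.
have Ur : U (0 + r *: c) by rewrite add0r; exact: KU.
have D := is_derive_saddle_field oU Ur g2; rewrite add0r in D.
have near01 : \forall s \near r, 0 < s <= 1.
  near=> s; apply/andP; split; first by near: s; exact: lt_nbhsr.
  by apply: ltW; near: s; exact: lt_nbhsl.
have J1 : Pi *m (matA phi (r *: c) + matB phi (r *: c)) *m c = Pi *m f c.
  rewrite -mulmxA.
  have D1 := is_derive_mulmxr Pi D.
  have D2 : is_derive r 1 (fun s => Pi *m f (0 + s *: c)) (Pi *m f c).
    apply: near_eq_is_derive (is_derive_line 0 (Pi *m f c) r).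
    near=> s; rewrite !add0r recurrent_field_scale//.
    have : 0 < s <= 1 by near: s.
    by move=> /andP[/ltW -> ->].
  by rewrite -(@derive_val _ _ _ _ _ _ _ D1) -(@derive_val _ _ _ _ _ _ _ D2).
have J2 : dot ((matA phi (r *: c) + matB phi (r *: c)) *m c) c = 0.
  have D1 := is_derive_dot D (is_derive_cst c r 1).
  have D2 : is_derive r 1 (fun s => dot (f (0 + s *: c)) c) 0.
    apply: near_eq_is_derive (is_derive_cst 0 r 1).
    near=> s; have /andP[s0 s1] : 0 < s <= 1 by near: s.
    have := recurrent_field_orth (@recurrent_scale c s Ic _); rewrite (ltW s0) s1 => /(_ isT).
    rewrite dotZr => /eqP; rewrite mulf_eq0 gt_eqF//= => /eqP.
    by rewrite add0r /cst.
  have := @derive_val _ _ _ _ _ _ _ D2; rewrite (@derive_val _ _ _ _ _ _ _ D1).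
  by rewrite dot0r add0r.
have J3 : Pi *m matB phi (r *: c) *m Pi *m c = 0.
  apply: semidefinite_kernel.
  - by rewrite !trmx_mul (proj_sym aV V0 PiE) (matB_sym oU (KU _ Krc) g2) mulmxA.
  - move=> v; rewrite -!mulmxA dot_mulmx (proj_sym aV V0 PiE).
    have := saddle_jacobian_neg (recurrent_face Irc) (proj_mem aV V0 PiE v).
    by rewrite mulmxDl dotDl matA_quadratic// add0r.
  - rewrite -!mulmxA dot_mulmx (proj_sym aV V0 PiE) proj_recurrent//.
    by move: J2; rewrite mulmxDl dotDl matA_quadratic// add0r.
split=> //; have J4 : Pi *m matB phi (r *: c) *m c = 0.
  by rewrite -J3 -[in RHS]mulmxA proj_recurrent.
rewrite -mulmxA proj_recurrent// -J1.
move: (matA _ _) (matB _ _) J4 => A B J4.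
by rewrite mulmxDr mulmxDl J4 addr0.
Unshelve. all: by end_near. Qed.

Lemma recurrent_kernel c (r : R) : rec c -> 0 <= r <= 1 ->
  Pi *m matB phi (r *: c) *m Pi *m c = 0 /\ Pi *m matA phi (r *: c) *m Pi *m c = Pi *m f c.
Proof.
move=> Ic /andP[r0 r1]; have [Krc _] := recurrent_scale Ic (introT andP (conj r0 r1)).
have [U [oU KU g2]] := phi2.
(* Pulling [r] towards 1/2 approaches the endpoints from inside the open interval. *)
pose t k : R := (1 - harmonic k) * r + harmonic k / 2.
have t01 k : 0 < t k < 1.
  have h0 : 0 < harmonic k :> R by rewrite /harmonic invr_gt0.
  have h1 : harmonic k <= 1 :> R by rewrite /harmonic invf_le1// ler1n.
  by rewrite /t; move: (harmonic k) h0 h1 => h h0 h1; apply/andP; split; nra.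
have hc : (@harmonic R) k @[k --> \oo] --> (0 : R) by exact: cvg_harmonic.
have tr : t k @[k --> \oo] --> (1 - 0) * r + 0 / 2.
  apply: cvgD; apply: cvgM => //; [|exact: cvg_cst|exact: cvg_cst].
  by apply: cvgB => //; exact: cvg_cst.
rewrite subr0 mul1r mul0r addr0 in tr.
have [cA cB] := cvg_matAB (KU _ Krc) g2 (cvgZr_tmp (a := c) tr).
have cPP (M : nat -> 'M[R]_(n + m)) (L : 'M[R]_(n + m)) (l : E) :
    M k @[k --> \oo] --> L -> (forall k, Pi *m M k *m Pi *m c = l) -> Pi *m L *m Pi *m c = l.
  move=> ML Ml.
  have H : Pi *m M k *m Pi *m c @[k --> \oo] --> Pi *m L *m Pi *m c.
    apply: cvg_mulmx; [|exact: cvg_cst]; apply: cvg_mulmx; [|exact: cvg_cst].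
    by apply: cvg_mulmx => //; exact: cvg_cst.
  rewrite (_ : (fun k => _) = fun=> l) in H; last exact/funext.
  by apply: (norm_cvg_unique H); exact: cvg_cst.
split; first by apply: (cPP _ _ _ cB) => k; have [] := recurrent_kernel_interior Ic (t01 k).
by apply: (cPP _ _ _ cA) => k; have [] := recurrent_kernel_interior Ic (t01 k).
Qed.

End LimitSet.

End SubgradientFlow.

Theorem theorem36 (R : realType) (n m : nat)
    (Kx : set 'cV[R]_n) (Ky : set 'cV[R]_m)
    (phi : 'cV[R]_n -> 'cV[R]_m -> R)
    (K := product_set Kx Ky)
    (F := minimal_face K (restricted_saddle K phi))
    (V := affine_span F)
    (Pi : 'M[R]_(n + m))
    (Phi : R -> 'cV[R]_(n + m) -> 'cV[R]_(n + m)) :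
  closed Kx -> convex_set Kx ->
  closed Ky -> convex_set Ky ->
  C2_near K (joint phi) ->
  concave_convex_on Kx Ky phi ->
  restricted_saddle K phi 0 ->
  (forall v : 'cV[R]_(n + m),
     Pi *m v = euclidean_proj (orth_complement (affine_normal_cone V)) v) ->
  is_subgradient_method K phi Phi ->
  ~ (exists z : R -> 'cV[R]_(n + m),
      [/\ complete_trajectory K Phi z,
          ~ (exists c, forall t, z t = c),
          (forall t : R, is_derive t 1 z (Pi *m matA phi 0 *m Pi *m z t)) &
          (forall r t : R, 0 <= r <= 1 ->
             (null_space (Pi *m matB phi (r *: z t) *m Pi) `&`
              null_space (Pi *m (matA phi (r *: z t) - matA phi 0) *m Pi)) (z t))]) ->
  globally_convergent K Phi.
Proof.
move=> clKx cKx clKy cKy phi2 phicc saddle0 PiE flow noz x Kx0.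
have convK : segment_convex K := segment_convex_product cKx cKy.
have K0 : K 0 by case: saddle0.
have clK : closed K := closed_product clKx clKy.
have PhiK := flowK flow; have Phi0 := flow0 flow; have PhiD := flowD flow.
have Phi_ne := flow_nonexpansive phi2 phicc flow.
have Phi_0 (t : R) : 0 <= t -> Phi t 0 = 0.
  by move=> t0; have [_ ->] := (equilibrium_saddle cKx cKy phi2 phicc flow 0).2 saddle0.
have [y [yK xy ry]] := orbit_cluster clK K0 PhiK PhiD Phi_ne Phi_0 Kx0.
have [ey|ney] := pselect (equilibrium K Phi y).
  by exists y; split => //; exact: (cvg_to_equilibrium PhiK PhiD Phi_ne Kx0 ey xy).
exfalso; apply: noz.
have /choice[sq sqP] : forall k : nat, exists s : R, k%:R <= s /\
    dot (Phi s y - y) (Phi s y - y) < k.+1%:R^-1.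
  by move=> k; have [s ks Hs] := ry k; exists s.
have sq_ge k : k%:R <= sq k by have [] := sqP k.
have Iy : recurrent K Phi sq y.
  split=> //; apply: cvg_dot_dist0.
  apply: (squeeze_cvgr _ (cvg_cst 0) cvg_harmonic).
  by near=> k; rewrite dot_ge0/= ltW//; have [] := sqP k.
have [z [z0 Iz zD]] := recurrent_complete clK K0 PhiK Phi0 PhiD Phi_ne Phi_0 sq_ge Iy.
have kernel t r r01 := recurrent_kernel clKx clKy cKx cKy phi2 phicc flow saddle0 PiE
  sq_ge (r := r) (Iz t) r01.
have r0 : 0 <= (0 : R) <= 1 by rewrite lexx ler01.
exists z; split.
- split=> [t|s t s0]; first by have [] := Iz t.
  exact: zD.
(* A constant [z] would make its value [y] at time 0 an equilibrium. *)
- move=> [c zc]; apply: ney; split => // t t0.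
  by rewrite -{1}z0 -zD// !zc -z0 zc.
(* The instance at scale 0 replaces the nonlinear velocity by the linear one. *)
- move=> t; have [_] := kernel t 0 r0; rewrite scale0r => ->.
  exact: (recurrent_derive clKx clKy cKx cKy phi2 phicc flow saddle0 PiE sq_ge).
move=> r t r01; have [kB kA] := kernel t r r01; split; first exact: kB.
have [_ kA0] := kernel t 0 r0; rewrite scale0r in kA0.
move: (matA phi (r *: z t)) (matA phi 0) kA kA0 => A A0 kA kA0.
have -> : Pi *m (A - A0) *m Pi = Pi *m A *m Pi - Pi *m A0 *m Pi.
  by rewrite mulmxBr mulmxBl.
by rewrite /null_space /= mulmxBl kA kA0 subrr.
Unshelve. all: by end_near. Qed.
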